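(* Let $n>0$. The ODE problem $$F^{(4)} = F - |F|^{-\frac{n}{n+1}}F \quad \text{in } \mathbb{R}$$ has at least a countable set of different solutions, denoted by $\{F_l,\ l\ge 0\}$, each one obtained as a critical point of the functional $$E(F) = -\frac12\int (F'')^2\,dy + \frac12\int F^2\,dy - \frac1\nu\int |F|^\nu\,dy, \qquad \nu=\frac{n+2}{n+1}\in(1,2),$$ in $W^2_{2,0}(B_R)$ with sufficiently large $R>0$.
   Context: $B_R=(-R,R)\subset\mathbb{R}$, and $W^2_{2,0}(B_R)$ is the Sobolev space of functions $F$ on $B_R$ with $F,F',F''\in L^2(B_R)$ satisfying Dirichlet boundary conditions $F=F'=0$ at the end points $\pm R$ (usually denoted $H^2_0(B_R)$). On $W^2_{2,0}(B_R)$ the integrals in $E$ are taken over $B_R$. The nonlinearity $|F|^{-\frac{n}{n+1}}F$ means $|F|^{\frac1{n+1}}\,\mathrm{sign}\,F$, equal to $0$ at $F=0$. *)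

(* Defs.v *)
From HB Require Import structures.
From mathcomp Require Import all_boot all_order all_algebra.
From mathcomp Require Import all_classical all_reals all_analysis.
Set Implicit Arguments.
Unset Strict Implicit.
Unset Printing Implicit Defensive.
Import Order.TTheory GRing.Theory Num.Theory.
Import numFieldNormedType.Exports.
Local Open Scope classical_set_scope.
Local Open Scope ring_scope.

(* Functions on the interval B_r = (-r, r) are represented by functions R -> R
   whose values outside B_r are irrelevant (except for test functions, which
   vanish there). A class of L^2(B_r) is represented by any of its Borel
   measurable members. *)

Definition Bset (R : realType) (r : R) : set R := `](- r), r[.

Definition Bint (R : realType) (r : R) (f : R -> R) : R :=
  Rintegral (@lebesgue_measure R) (Bset r) f.

(* L^2(B_r), through the extension by 0 outside B_r *)
Definition inL2 (R : realType) (r : R) (f : R -> R) : Prop :=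
  f \_ (Bset r) \in Lfun (@lebesgue_measure R) 2%:E.

(* phi is a C^1 function with compact support in B_r *)
Definition test_fun (R : realType) (r : R) (phi : R -> R) : Prop :=
  [/\ forall x, derivable phi x 1,
      continuous (derive1 phi) &
      exists2 s : R, s < r & forall x, s <= `|x| -> phi x = 0].

(* f and g are in L^2(B_r) and g = f' weakly; C^1_c and C^oo_c test functions give
   the same notion. *)
Definition is_wderiv (R : realType) (r : R) (f g : R -> R) : Prop :=
  [/\ inL2 r f, inL2 r g &
      forall phi, test_fun r phi ->
        Bint r (fun x => f x * derive1 phi x) = - Bint r (fun x => g x * phi x)].

(* The weak derivative, unique a.e. on B_r; 0 (junk value) if f has none in L^2. *)
Definition wderiv (R : realType) (r : R) (f : R -> R) : R -> R :=
  xget (fun=> 0) [set g | is_wderiv r f g].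

(* f = 0 at the end points, in the sense of its continuous representative *)
Definition zero_trace (R : realType) (r : R) (f : R -> R) : Prop :=
  exists f0 : R -> R,
    [/\ {ae (@lebesgue_measure R), forall x, Bset r x -> f x = f0 x},
        {within `[(- r), r], continuous f0},
        f0 (- r) = 0 & f0 r = 0].

(* The Sobolev space W^2_{2,0}(B_r), i.e. H^2_0(B_r) *)
Definition W220 (R : realType) (r : R) (F : R -> R) : Prop :=
  exists F1 F2 : R -> R,
    [/\ is_wderiv r F F1, is_wderiv r F1 F2, zero_trace r F & zero_trace r F1].

Definition W22norm (R : realType) (r : R) (F : R -> R) : R :=
  Num.sqrt (Bint r (fun x => F x ^+ 2)
            + Bint r (fun x => wderiv r F x ^+ 2)
            + Bint r (fun x => wderiv r (wderiv r F) x ^+ 2)).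

Definition nu (R : realType) (n : R) : R := (n + 2) / (n + 1).

Definition energy (R : realType) (n r : R) (F : R -> R) : R :=
  - (2^-1 * Bint r (fun x => wderiv r (wderiv r F) x ^+ 2))
  + 2^-1 * Bint r (fun x => F x ^+ 2)
  - (nu n)^-1 * Bint r (fun x => `|F x| `^ nu n).

(* The Frechet derivative at F of the functional J on W^2_{2,0}(B_r) is zero *)
Definition critical_point (R : realType) (r : R) (J : (R -> R) -> R)
    (F : R -> R) : Prop :=
  W220 r F /\
  forall e : R, 0 < e -> exists2 d : R, 0 < d &
    forall V : R -> R, W220 r V -> W22norm r V <= d ->
      `|J (F \+ V) - J F| <= e * W22norm r V.

(* |u|^{-n/(n+1)} u, read as |u|^{1/(n+1)} sign u *)
Definition nonlin (R : realType) (n u : R) : R :=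
  `|u| `^ (n + 1)^-1 * Num.sg u.

(* F is a classical solution on the whole line *)
Definition solves_ode (R : realType) (n : R) (F : R -> R) : Prop :=
  (forall (k : nat) (x : R), (k < 4)%N -> derivable (derive1n k F) x 1) /\
  (forall x : R, derive1n 4 F x = F x - nonlin n (F x)).

(* Main.v *)
Require Import Defs.
From mathcomp Require Import all_boot all_order all_algebra.
From mathcomp Require Import all_classical all_reals all_analysis.
From mathcomp Require Import measurable_realfun ring lra zify.
Set Implicit Arguments.
Unset Strict Implicit.
Unset Printing Implicit Defensive.
Import Order.TTheory GRing.Theory Num.Theory.
Import numFieldNormedType.Exports.
Local Open Scope classical_set_scope.
Local Open Scope ring_scope.

(** Write a = 1/(n+1), so that the equation reads F'''' = F - |F|^a sgn F with
    0 < a < 1. The absorption term |F|^a is sublinear, hence stronger than F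
    where F is small, and it forces solutions to vanish identically wherever
    they are small enough: there are nonzero solutions of compact support. One
    of them is enough. Its translates by multiples of the radius of its support
    are pairwise different solutions on the line, and a solution supported
    inside B_r is a critical point of E on H^2_0(B_r): the linear part of
    E(F + V) - E(F) vanishes after two integrations by parts, which leave no
    boundary term, and the remainder is O(|V|^2 + |V|^(1+a)) in norm.

    Existence ([compact_solution]) is a variational argument carried out on a
    finite lattice, where compactness is free. On a cycle of N points with mesh
    1/k, minimise
      J(f) = 1/2 sum k^4 |D^2 f|^2 + 1/(1+a) sum |f|^(1+a)
    on the sphere sum f^2 = k ([cyc_minimizer]). The multiplier lam in
    k^4 D^4 f = lam f - |f|^a sgn f ([cyc_euler_lagrange]) is bounded above by
    the energy of a fixed bump ([cyc_bump]), and lam and max |f| are bounded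
    below because sum f^2 <= (max |f|)^(1-a) sum |f|^(1+a). Interpolation
    between f and D^4 f bounds all the difference quotients
    ([diffq_interpolation]). Recentre at a maximum of |f| and let the mesh tend
    to 0 and the length of the cycle to infinity. Limits along an ultrafilter
    exist pointwise, and uniform moduli of continuity turn difference quotients
    into derivatives ([ulim_derive]). The limit F solves
    F'''' = lam F - |F|^a sgn F, it is nonzero at 0, and it is square
    integrable, hence tends to 0 at infinity ([decay]). Mass may escape to
    infinity on the way; this is harmless, since nothing but F(0) <> 0 is kept.

    The support is compact by an energy estimate of Bernis type
    ([dead_core_bound]): testing the equation with (1 - y^2)^4 F on an interval
    where |F| <= M bounds |F|^(2+a) at the centre by a multiple of M^3. As
    3 > 2 + a, iterating on shrinking intervals around c gives F(c) = 0 as soon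
    as |F| is small on [c - 1, c + 1] ([dead_core]). Finally an affine change
    of variables makes lam = 1 ([ode_chain_affine]). *)

(** * Real powers and derivatives *)

Section Real.
Context {R : realType}.
Implicit Types (a x y t : R) (f F : R -> R).

Lemma is_derive_littleo F x D :
  (forall e, 0 < e -> exists2 d : R, 0 < d &
     forall y, `|y - x| < d -> `|F y - F x - (y - x) * D| <= e * `|y - x|) ->
  is_derive x 1 F D.
Proof.
move=> H.
have lim : h^-1 *: (F (h *: 1 + x) - F x) @[h --> 0^'] --> D.
  apply/cvgrPdist_le => e e0.
  have [d d0 Hd] := H e e0.
  near=> h.
  have h0 : h != 0 by near: h; exact: nbhs_dnbhs_neq.
  have hd : `|h| < d by near: h; exact: dnbhs0_lt.
  have := Hd (h + x); rewrite addrK => /(_ hd) K.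
  rewrite /GRing.scale /= mulr1 distrC -(@ler_pM2l _ `|h|) ?normr_gt0//.
  by rewrite -normrM mulrBr mulVKf// [X in _ <= X]mulrC.
apply: DeriveDef.
  by rewrite /derivable; apply/cvg_ex; exists D.
by rewrite /derive; apply: cvg_lim => //.
Unshelve. all: by end_near. Qed.

Lemma is_derive_cont F x D : is_derive x 1 F D -> {for x, continuous F}.
Proof. by move=> [/derivable1_diffP/differentiable_continuous]. Qed.

Lemma le_diff_of_derive F dF (m p q : R) : p <= q ->
  (forall x, is_derive x 1 F (dF x)) ->
  (forall x, p <= x <= q -> m <= dF x) -> m * (q - p) <= F q - F p.
Proof.
move=> pq HF Hm.
have [c cpq ->] : exists2 c, c \in `[p, q] & F q - F p = dF c * (q - p).
  apply: MVT_segment => //; apply: continuous_subspaceT => x.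
  exact: (is_derive_cont (HF x)).
by apply: ler_wpM2r; [rewrite subr_ge0 | apply: Hm; rewrite in_itv/= in cpq].
Qed.

Definition spow a (u : R) := `|u| `^ a * Num.sg u.

Lemma spow0 a : spow a 0 = 0.
Proof. by rewrite /spow sgr0 mulr0. Qed.

Lemma spowN a u : spow a (- u) = - spow a u.
Proof. by rewrite /spow normrN sgrN mulrN. Qed.

Lemma spow_ge0 a u : 0 <= u -> spow a u = u `^ a * (u != 0)%:R.
Proof.
by move=> u0; rewrite /spow ger0_norm// sgr_def ltNge u0/= expr0.
Qed.

Lemma spow_pos a u : 0 < a -> 0 <= u -> spow a u = u `^ a.
Proof.
move=> a0 u0; rewrite spow_ge0//; have [->|] := eqVneq u 0; rewrite ?mulr1//.
by rewrite powR0 ?gt_eqF// mul0r.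
Qed.

Lemma norm_spow a u : 0 < a -> `|spow a u| = `|u| `^ a.
Proof.
move=> a0; have [u0|u0] := leP 0 u.
  by rewrite spow_pos// !ger0_norm// powR_ge0.
rewrite -[in LHS](opprK u) spowN normrN spow_pos ?oppr_ge0 ?ltW//.
by rewrite ger0_norm ?powR_ge0// ltr0_norm.
Qed.

Lemma spow_mulr a u : 0 < a -> spow a u * u = `|u| `^ (1 + a).
Proof.
move=> a0; rewrite /spow -mulrA -normrEsg mulrC.
have [->|u0] := eqVneq u 0.
  by rewrite normr0 mul0r powR0// gt_eqF// addr_gt0.
by rewrite powRD ?powRr1// normr_eq0 u0 implybT.
Qed.

(** With s = x + y, concavity in the form (x / s)^a >= x / s on [0, 1], added to
    the same inequality for y. *)
Lemma powR_subadd a x y : 0 < a <= 1 -> 0 <= x -> 0 <= y ->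
  (x + y) `^ a <= x `^ a + y `^ a.
Proof.
move=> /andP[a0 a1] x0 y0.
have [s0|s0] := eqVneq (x + y) 0.
  by rewrite s0 powR0 ?gt_eqF// addr_ge0// powR_ge0.
have s : 0 < x + y by rewrite lt_neqAle eq_sym s0 addr_ge0.
have key z : 0 <= z -> z <= x + y -> z / (x + y) * (x + y) `^ a <= z `^ a.
  move=> z0 zs.
  have -> : z `^ a = (z / (x + y)) `^ a * (x + y) `^ a.
    by rewrite -powRM ?divfK// ?(ltW s)// divr_ge0// ltW.
  apply: ler_wpM2r; first exact: powR_ge0.
  have [->|zn] := eqVneq z 0; first by rewrite mul0r powR_ge0.
  by apply: ger1_powR => //; rewrite ler_pdivrMr// mul1r zs andbT divr_gt0// lt_neqAle eq_sym zn.
have := lerD (key x x0 _) (key y y0 _).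
rewrite -mulrDl -mulrDl mulfV// mul1r; apply; lra.
Qed.

Lemma spow_hoelder a x y : 0 < a <= 1 ->
  `|spow a x - spow a y| <= 2 * `|x - y| `^ a.
Proof.
move=> ha; have /andP[a0 a1] := ha.
wlog xy : x y / y <= x.
  move=> H; have [|/ltW] := leP y x; first exact: H.
  by move=> /H; rewrite distrC [X in _ <= 2 * (X `^ _)]distrC.
have P z : 0 <= z `^ a by apply: powR_ge0.
have same (u v : R) : 0 <= v -> v <= u -> `|spow a u - spow a v| <= 2 * `|u - v| `^ a.
  move=> v0 vu; have u0 := le_trans v0 vu.
  rewrite !spow_pos// ger0_norm ?subr_ge0 ?ge0_ler_powR ?nnegrE ?(ltW a0)//.
  rewrite (@ger0_norm _ (u - v)) ?subr_ge0//.
  have := @powR_subadd a v (u - v) ha v0; rewrite subr_ge0 => /(_ vu).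
  rewrite subrKC => H; have := P (u - v); lra.
have [y0|y0] := leP 0 y; first exact: same.
have [x0|x0] := leP x 0.
  have := same (- y) (- x); rewrite oppr_ge0 lerN2 => /(_ x0 xy).
  by rewrite !spowN !opprK addrC (addrC (- y)).
rewrite -{1}(opprK y) spowN opprK !spow_pos ?oppr_ge0 ?(ltW y0) ?(ltW x0)//.
rewrite ger0_norm ?addr_ge0// (@ger0_norm _ (x - y)) ?subr_ge0//.
have : x `^ a <= (x - y) `^ a by apply: ge0_ler_powR; rewrite ?nnegrE; lra.
have : (- y) `^ a <= (x - y) `^ a by apply: ge0_ler_powR; rewrite ?nnegrE; lra.
lra.
Qed.

Lemma powR_small a (e : R) : 0 < a -> 0 < e ->
  exists2 d : R, 0 < d & forall x, 0 <= x <= d -> x `^ a <= e.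
Proof.
move=> a0 e0; exists (e `^ a^-1); first exact: powR_gt0.
move=> x /andP[x0 xd].
have -> : e = (e `^ a^-1) `^ a by rewrite -powRrM mulVf ?gt_eqF// powRr1 ?ltW.
by rewrite ge0_ler_powR ?nnegrE ?powR_ge0// ltW.
Qed.

Lemma continuous_spow a : 0 < a <= 1 -> continuous (spow a).
Proof.
move=> ha x; have /andP[a0 _] := ha; apply/cvgrPdist_le => e e0.
have [d d0 Hd] := @powR_small a (e / 2) a0 (divr_gt0 e0 (ltr0Sn _ 1)).
near=> y; apply: (le_trans (spow_hoelder _ _ ha)).
have := Hd `|x - y|; rewrite normr_ge0/= => H.
suff /H : `|x - y| <= d by lra.
by near: y; apply: cvgr_dist_le.
Unshelve. all: by end_near. Qed.

Lemma is_derive_abs_powR a x : 0 < a ->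
  is_derive x 1 (fun u => `|u| `^ (1 + a)) ((1 + a) * spow a x).
Proof.
move=> a0; have a1 : 0 < 1 + a by rewrite addr_gt0.
have pos (z : R) : 0 < z ->
    is_derive z 1 (fun u => `|u| `^ (1 + a)) ((1 + a) * spow a z).
  move=> z0.
  have := is_derive1_powR (1 + a) z0.
  rewrite (_ : 1 + a - 1 = a) => [K|]; last by lra.
  rewrite spow_pos ?ltW//.
  apply: near_eq_is_derive K; near=> u; rewrite ger0_norm//; apply/ltW; near: u; exact: lt_nbhsr.
have [x0|x0|->] := ltgtP x 0; last 2 first.
- exact: pos.
- rewrite spow0 mulr0; apply: is_derive_littleo => e e0.
  have [d d0 Hd] := powR_small a0 e0; exists d => // y.
  rewrite subr0 => yd; rewrite normr0 powR0 ?gt_eqF// mulr0 !subr0.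
  rewrite ger0_norm ?powR_ge0//.
  have [->|y0] := eqVneq y 0; first by rewrite normr0 powR0 ?mulr0// gt_eqF.
  rewrite powRD ?powRr1// ?normr_eq0 ?y0 ?implybT// mulrC.
  by apply: ler_wpM2r => //; apply: Hd; rewrite normr_ge0 ltW.
have nx : 0 < - x by rewrite oppr_gt0.
have := @is_derive1_comp R (fun u => `|u| `^ (1 + a)) -%R x _ _ (pos _ nx) (is_deriveNid x 1).
rewrite mulrN1 spowN mulrN opprK => K.
by apply: near_eq_is_derive K; near=> u; rewrite /= normrN.
Unshelve. all: by end_near. Qed.

(** The mean value theorem turns the remainder into an increment of the
    derivative (1 + a) [spow a], which is only Hoelder continuous: hence the
    order 1 + a instead of 2. *)
Lemma abs_powR_taylor a x y : 0 < a <= 1 ->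
  `| `|x + y| `^ (1 + a) - `|x| `^ (1 + a) - (1 + a) * spow a x * y|
    <= 4 * `|y| `^ (1 + a).
Proof.
move=> ha; have /andP[a0 a1] := ha.
have key p q z : p <= q -> (p <= z <= q) -> 
  `| `|q| `^ (1 + a) - `|p| `^ (1 + a) - (1 + a) * spow a z * (q - p)|
    <= 4 * `|q - p| `^ (1 + a).
  move=> pq zpq.
  have [c cpq ->] : exists2 c, c \in `[p, q] &
     `|q| `^ (1 + a) - `|p| `^ (1 + a) = (1 + a) * spow a c * (q - p).
    apply: (@MVT_segment _ (fun u => `|u| `^ (1 + a)) (fun c => (1 + a) * spow a c)) => //.
    - by move=> u _; exact: is_derive_abs_powR.
    - apply: continuous_subspaceT => u.
      exact: (is_derive_cont (is_derive_abs_powR u a0)).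
  rewrite in_itv/= in cpq.
  rewrite -mulrBl -mulrBr !normrM.
  have [qp0|qp0] := eqVneq (q - p) 0.
    by rewrite qp0 normr0 mulr0 mulr_ge0// powR_ge0.
  rewrite powRD ?powRr1// ?normr_eq0 ?qp0 ?implybT// [`|q - p| * _]mulrC !mulrA.
  apply: ler_wpM2r => //.
  apply: (@le_trans _ _ (2 * (2 * `|q - p| `^ a))); last by lra.
  apply: ler_pM => //; first by rewrite ger0_norm; lra.
  apply: (le_trans (spow_hoelder _ _ ha)); rewrite ler_pM2l//.
  apply: ge0_ler_powR; rewrite ?nnegrE ?(ltW a0)//.
  by rewrite (@ger0_norm _ (q - p)) ?subr_ge0// ler_norml; lra.
have [y0|y0] := leP 0 y.
  have := key x (x + y) x; rewrite [x + y - x]addrC addKr; apply; lra.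
have := key (x + y) x x; rewrite (_ : x - (x + y) = - y); last by lra.
rewrite normrN mulrN opprK => H.
set A := `|x + y| `^ _ in H *; set B := `|x| `^ _ in H *.
rewrite (_ : A - B - _ = - (B - A + (1 + a) * spow a x * y)); last by lra.
by rewrite normrN; apply: H; lra.
Qed.

End Real.

(** * The local energy estimate *)

Section Derivation.
Context {R : realType}.
Implicit Types (f g : R -> R) (x c : R).

(** Unlike [is_derive], not a class: otherwise type class resolution would
    attempt the premises of the rules below. *)
Definition is_der f x (p : R) : Prop := is_derive x 1 f p.

Lemma derD f g x (p q : R) : is_der f x p -> is_der g x q ->
  is_der (fun y => f y + g y) x (p + q).
Proof. by move=> ? ?; exact: is_deriveD. Qed.

Lemma derB f g x (p q : R) : is_der f x p -> is_der g x q ->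
  is_der (fun y => f y - g y) x (p - q).
Proof. by move=> ? ?; exact: is_deriveB. Qed.

Lemma derM f g x (p q : R) : is_der f x p -> is_der g x q ->
  is_der (fun y => f y * g y) x (f x * q + g x * p).
Proof. by move=> ? ?; exact: is_deriveM. Qed.

Lemma derX f n x (p : R) : is_der f x p ->
  is_der (fun y => f y ^+ n.+1) x (n.+1%:R * f x ^+ n * p).
Proof.
by move=> fp; have := is_deriveX n.+1 fp; rewrite exprfctE.
Qed.

Lemma der_comp f g x (p q : R) : is_der f (g x) p -> is_der g x q ->
  is_der (fun y => f (g y)) x (p * q).
Proof. by rewrite /is_der => ? ?; exact: is_derive1_comp. Qed.

Lemma derc x c : is_der (fun=> c) x 0.
Proof. exact: is_derive_cst. Qed.

Lemma derid x : is_der (fun y : R => y) x 1.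
Proof. exact: is_derive_id. Qed.

Lemma der_eq f x (p q : R) : is_der f x p -> p = q -> is_der f x q.
Proof. by move=> + <-. Qed.

Lemma der_derive1 f (f1 : R -> R) : (forall x, is_der f x (f1 x)) -> derive1 f = f1.
Proof.
move=> df; apply/funext => x; rewrite derive1E.
exact: (@derive_val _ _ _ _ _ _ _ (df x)).
Qed.

Lemma der_continuous f (f1 : R -> R) : (forall x, is_der f x (f1 x)) -> continuous f.
Proof. by move=> df x; exact: (is_derive_cont (df x)). Qed.

Lemma der_affine f c k x (p : R) (C : R) : is_der f (c + k * x) p ->
  is_der (fun y => C * f (c + k * y)) x (C * k * p).
Proof.
move=> fp.
have h : is_der (fun y : R => c + k * y) x k.
  apply: der_eq; first by eapply derD; [exact: derc|eapply derM; [exact: derc|exact: derid]].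
  by rewrite /=; ring.
apply: der_eq; first by eapply derM; [exact: derc|exact (@der_comp f (fun y => c + k * y) x _ _ fp h)].
by rewrite /=; ring.
Qed.

End Derivation.

Ltac der := repeat first [exact: derc|exact: derid|eapply derB|eapply derD|eapply derX|eapply derM].

Section DeadCore.
Context {R : realType}.
Variables (a mu ka : R) (G G1 G2 G3 : R -> R).
Hypothesis a01 : 0 < a < 1.
Hypothesis mu0 : 0 <= mu.
Hypothesis ka0 : 0 < ka.
Hypothesis dG : forall x, is_der G x (G1 x).
Hypothesis dG1 : forall x, is_der G1 x (G2 x).
Hypothesis dG2 : forall x, is_der G2 x (G3 x).
Hypothesis dG3 : forall x, is_der G3 x (mu * G x - ka * spow a (G x)).

(* Psi = (eta G)' G'' - eta G G''' + theta G G' - theta' G^2 / 2 with the weights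
   eta = (1 - x^2)^4 and theta = 4 eta'^2 / eta = 256 x^2 (1 - x^2)^2. The last two
   terms trade G'^2, which comes with no good sign, for G G'' and G^2. *)
Let Psi x := (- 8 * x * (1 - x ^+ 2) ^+ 3 * G x + (1 - x ^+ 2) ^+ 4 * G1 x) * G2 x
  - (1 - x ^+ 2) ^+ 4 * G x * G3 x
  + 256 * x ^+ 2 * (1 - x ^+ 2) ^+ 2 * (G x * G1 x)
  - 256 * x * (1 - x ^+ 2) * (1 - 3 * x ^+ 2) * G x ^+ 2.

(* The derivative of Psi. The two squares absorb the products 2 eta' G' G'' and
   (theta + eta'') G G''. *)
Let dPsi x := 2^-1 * (1 - x ^+ 2) ^+ 4 * G2 x ^+ 2
  + ka * (1 - x ^+ 2) ^+ 4 * `|G x| `^ (1 + a)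
  + (2^-1 * (1 - x ^+ 2) ^+ 2 * G2 x - 16 * x * (1 - x ^+ 2) * G1 x) ^+ 2
  + (2^-1 * (1 - x ^+ 2) ^+ 2 * G2 x + (312 * x ^+ 2 - 8) * G x) ^+ 2
  - ((312 * x ^+ 2 - 8) ^+ 2 + 256 * (1 - 12 * x ^+ 2 + 15 * x ^+ 4)
     + mu * (1 - x ^+ 2) ^+ 4) * G x ^+ 2.

Lemma is_derive_Psi x : is_der Psi x (dPsi x).
Proof.
have a0 : 0 < a by case/andP: a01.
apply: der_eq.
  by rewrite /Psi; der; first [exact: dG|exact: dG1|exact: dG2|exact: dG3].
by rewrite /dPsi -spow_mulr//=; field.
Qed.

Variable M : R.
Hypothesis M0 : 0 < M.
Hypothesis GM : forall x, -1 <= x <= 1 -> `|G x| <= M.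

(* 10^5 exceeds the maximum on [-1, 1] of the polynomial in [zero_order_bound]. *)
Let K0 := 1000 * 100 + mu.

Lemma zero_order_bound x : -1 <= x <= 1 ->
  ((312 * x ^+ 2 - 8) ^+ 2 + 256 * (1 - 12 * x ^+ 2 + 15 * x ^+ 4)
     + mu * (1 - x ^+ 2) ^+ 4) * G x ^+ 2 <= K0 * M ^+ 2.
Proof.
move: (mu0) (ka0) (M0) => hmu hka hM.
move=> hx; have GM2 : G x ^+ 2 <= M ^+ 2.
  by rewrite -real_normK ?num_real// ler_sqr ?nnegrE ?(ltW M0)// GM.
have t01 : 0 <= x ^+ 2 <= 1 by rewrite sqr_ge0/=; nra.
rewrite (_ : x ^+ 4 = (x ^+ 2) ^+ 2); last by ring.
move: (x ^+ 2) t01 => t /andP[t0 t1].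
have e4 : (1 - t) ^+ 4 <= 1 by rewrite exprn_ile1//; lra.
have := ler_wpM2l mu0 e4; rewrite mulr1 => e4'.
have := sqr_ge0 (G x) => G2p.
apply: (@le_trans _ _ (K0 * G x ^+ 2)); last by rewrite ler_wpM2l// /K0; lra.
apply: ler_wpM2r => //; rewrite /K0; nra.
Qed.

Lemma dPsi_ge x : -1 <= x <= 1 -> - (K0 * M ^+ 2) <= dPsi x.
Proof.
move: (mu0) (ka0) (M0) => hmu hka hM.
move=> hx; have := zero_order_bound hx; rewrite /dPsi.
set A := (_ * _ ^+ 2 <= _); set S1 := (_ ^+ 2 in X in _ -> _ <= _ + _ + X + _ - _).
set S2 := (_ ^+ 2 in X in _ -> _ <= _ + X - _).
have : 0 <= 2^-1 * (1 - x ^+ 2) ^+ 4 * G2 x ^+ 2.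
  by apply: mulr_ge0 (sqr_ge0 _); apply: mulr_ge0 => //; exact: exprn_even_ge0.
have : 0 <= ka * (1 - x ^+ 2) ^+ 4 * `|G x| `^ (1 + a).
  by apply: mulr_ge0 (powR_ge0 _ _); apply: mulr_ge0 (ltW ka0) _; exact: exprn_even_ge0.
have : 0 <= S1 by exact: sqr_ge0.
have : 0 <= S2 by exact: sqr_ge0.
rewrite /A; lra.
Qed.

Lemma dPsi_ge_half x : - 2^-1 <= x <= 2^-1 ->
  8^-1 * G2 x ^+ 2 + ka / 4 * `|G x| `^ (1 + a) - K0 * M ^+ 2 <= dPsi x.
Proof.
move: (mu0) (ka0) (M0) => hmu hka hM.
move=> hx; have hx1 : -1 <= x <= 1 by lra.
have := zero_order_bound hx1; rewrite /dPsi.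
set A := (_ * _ ^+ 2 <= _); set S1 := (_ ^+ 2 in X in _ -> _ <= _ + _ + X + _ - _).
set S2 := (_ ^+ 2 in X in _ -> _ <= _ + X - _).
have e4 : 4^-1 <= (1 - x ^+ 2) ^+ 4.
  have : 3 / 4 <= 1 - x ^+ 2 by nra.
  rewrite (exprM _ 2 2 : _ ^+ 4 = _); move: (1 - x ^+ 2) => e he.
  have : 9 / 16 <= e ^+ 2 by nra.
  by move: (e ^+ 2) => f hf; nra.
have := ler_wpM2r (sqr_ge0 (G2 x)) e4.
have := ler_wpM2r (mulr_ge0 (ltW ka0) (powR_ge0 `|G x| (1 + a))) e4.
have : 0 <= S1 by exact: sqr_ge0.
have : 0 <= S2 by exact: sqr_ge0.
rewrite /A; lra.
Qed.

(** As Psi vanishes at both ends of [-1, 1] and Psi' >= - K0 M^2, the increase of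
    Psi on a subinterval is bounded by what it can lose outside. *)
Lemma Psi_diff p q : -1 <= p -> p <= q -> q <= 1 ->
  Psi q - Psi p <= K0 * M ^+ 2 * (2 - (q - p)).
Proof.
move: (mu0) (ka0) (M0) => hmu hka hM.
move=> p1 pq q1.
have P1 : Psi 1 = 0 by rewrite /Psi; ring.
have PN1 : Psi (-1) = 0 by rewrite /Psi; ring.
have := @le_diff_of_derive _ _ _ (- (K0 * M ^+ 2)) _ _ p1 is_derive_Psi.
have := @le_diff_of_derive _ _ _ (- (K0 * M ^+ 2)) _ _ q1 is_derive_Psi.
rewrite P1 PN1 => A B.
have /A A' : forall x, q <= x <= 1 -> - (K0 * M ^+ 2) <= dPsi x.
  by move=> x hx; apply: dPsi_ge; lra.
have /B B' : forall x, -1 <= x <= p -> - (K0 * M ^+ 2) <= dPsi x.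
  by move=> x hx; apply: dPsi_ge; lra.
lra.
Qed.

(** The term G2^2 / 8 in Psi' absorbs tau G2 up to 2 tau^2; the choice
    tau = M, - M balances the two errors. *)
Lemma G1_osc p q : - 2^-1 <= p -> p <= q -> q <= 2^-1 ->
  `|G1 q - G1 p| <= (2 * K0 + 2) * M.
Proof.
move: (mu0) (ka0) (M0) => hmu hka hM.
move=> p1 pq q1.
have key tau : tau * (G1 q - G1 p) <= 2 * K0 * M ^+ 2 + 2 * tau ^+ 2.
  have d (x : R) : is_der (fun y => Psi y - tau * G1 y) x (dPsi x - tau * G2 x).
    apply: der_eq; first by eapply derB; [exact: is_derive_Psi|eapply derM; [exact: derc|exact: dG1]].
    by rewrite /=; ring.
  have := @le_diff_of_derive _ _ _ (- (K0 * M ^+ 2) - 2 * tau ^+ 2) _ _ pq d.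
  have H x : p <= x <= q -> - (K0 * M ^+ 2) - 2 * tau ^+ 2 <= dPsi x - tau * G2 x.
    move=> hx; have hx' : - 2^-1 <= x <= 2^-1 by lra.
    have := dPsi_ge_half hx'.
    have : 0 <= ka / 4 * `|G x| `^ (1 + a).
      by rewrite !mulr_ge0 ?powR_ge0// ltW.
    have := sqr_ge0 (G2 x - 4 * tau).
    rewrite sqrrB; lra.
  move=> /(_ H).
  have pN1 : -1 <= p by lra. have qN1 : q <= 1 by lra.
  have := Psi_diff pN1 pq qN1.
  have : 0 <= tau ^+ 2 * (1 - (q - p)) by apply: mulr_ge0; [exact: sqr_ge0|lra].
  have := mulr_ge0 (ltW hM) (ltW hM).
  lra.
have H1 := key M; have H2 := key (- M).
rewrite ler_norml; apply/andP; split; rewrite -(ler_pM2l M0); lra.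
Qed.

Lemma G1_bound x : - 2^-1 <= x <= 2^-1 -> `|G1 x| <= (2 * K0 + 4) * M.
Proof.
move: (mu0) (ka0) (M0) => hmu hka hM.
move=> hx.
have [c] : exists2 c, c \in `[(- 2^-1), 2^-1] & G 2^-1 - G (- 2^-1) = G1 c * (2^-1 - - 2^-1).
  apply: MVT_segment => [|y _|]; [lra|exact: dG|].
  by apply: continuous_subspaceT => y; exact: (is_derive_cont (dG y)).
rewrite in_itv/= => hc E.
have h1 : `|G 2^-1| <= M by apply: GM; lra.
have h2 : `|G (- 2^-1)| <= M by apply: GM; lra.
have h3 : `|G1 x - G1 c| <= (2 * K0 + 2) * M.
  have [xc|cx] := leP x c; last by apply: G1_osc; lra.
  by rewrite distrC; apply: G1_osc; lra.
move: h1 h2 h3; rewrite !ler_norml; lra.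
Qed.

(** If |G(0)| = g then |G| >= g / 2 on an interval of length of order g / M, on
    which Psi increases at the rate ka g^(1+a); but the total variation of Psi is
    of order M^2. So ka g^(1+a) g / M is at most of order M^2. *)
Lemma dead_core_bound :
  ka * (`|G 0| * `|G 0| `^ (1 + a)) <= 64 * K0 * (2 * K0 + 4) * M ^+ 3.
Proof.
move: (mu0) (ka0) (M0) => hmu hka hM.
have K00 : 0 < K0 by rewrite /K0; lra.
set g := `|G 0|; set L := 2 * K0 + 4.
have L0 : 0 < L by rewrite /L; lra.
have M30 : 0 <= 64 * K0 * L * M ^+ 3 by rewrite !mulr_ge0 ?exprn_ge0 ?ltW.
have [->|g0] := eqVneq g 0; first by rewrite mul0r mulr0.
have gp : 0 < g by rewrite lt_neqAle eq_sym g0 normr_ge0.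
have gM : g <= M by apply: GM; lra.
set l := g / (2 * L * M).
have LM0 : 0 < 2 * L * M by rewrite !mulr_gt0.
have l0 : 0 < l by rewrite divr_gt0.
have lE : l * L * M = g / 2 by rewrite /l; field; rewrite !gt_eqF.
have l2 : l <= 2^-1.
  have : L * g <= L * M by rewrite ler_pM2l.
  have : M <= L * M by rewrite ler_peMl ?ltW// /L /K0; lra.
  by rewrite /l ler_pdivrMr//; lra.
have Gy y : 0 <= y <= l -> g / 2 <= `|G y|.
  move=> hy.
  have [c] : exists2 c, c \in `[0, y] & G y - G 0 = G1 c * (y - 0).
    apply: MVT_segment => [|z _|]; [lra|exact: dG|].
    by apply: continuous_subspaceT => z; exact: (is_derive_cont (dG z)).
  rewrite in_itv/= subr0 => hc E.
  have h1 : `|G1 c| <= L * M by apply: G1_bound; lra.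
  have : `|G y - G 0| <= g / 2.
    rewrite E normrM -lE.
    have : `|G1 c| * `|y| <= L * M * l.
      by apply: ler_pM => //; rewrite ger0_norm; lra.
    lra.
  have := ler_distD (G y) (G 0) 0; rewrite !subr0 distrC -/g; lra.
have a0 : 0 < 1 + a by case/andP: a01; lra.
have dlow y : 0 <= y <= l ->
    ka / 4 * (g / 2) `^ (1 + a) - K0 * M ^+ 2 <= dPsi y.
  move=> hy; have hy' : - 2^-1 <= y <= 2^-1 by lra.
  have := dPsi_ge_half hy'; have := sqr_ge0 (G2 y).
  have : ka / 4 * (g / 2) `^ (1 + a) <= ka / 4 * `|G y| `^ (1 + a).
    apply: ler_wpM2l; first by rewrite divr_ge0// ltW.
    apply: ge0_ler_powR; rewrite ?nnegrE ?(ltW a0)// ?Gy//.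
    by rewrite divr_ge0 ?ltW.
  lra.
have h1 := @le_diff_of_derive _ _ _ _ _ _ (ltW l0) is_derive_Psi dlow.
have h2 : Psi l - Psi 0 <= K0 * M ^+ 2 * (2 - (l - 0)) by apply: Psi_diff; lra.
have h3 : ka / 4 * (g / 2) `^ (1 + a) * l <= 2 * K0 * M ^+ 2.
  move: h1 h2; rewrite !subr0; lra.
have h4 : g `^ (1 + a) <= 4 * (g / 2) `^ (1 + a).
  have -> : g `^ (1 + a) = 2 `^ (1 + a) * (g / 2) `^ (1 + a).
    by rewrite -powRM ?divr_ge0 ?ltW// mulrC divfK// pnatr_eq0.
  apply: ler_wpM2r; first exact: powR_ge0.
  have -> : 4 = 2 `^ 2 :> R by rewrite (powR_mulrn 2)// -natrX.
  by apply: ler_powR; [lra|case/andP: a01; lra].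
have h5 : ka * (g * g `^ (1 + a)) <= ka * (g * (4 * (g / 2) `^ (1 + a))).
  by rewrite !ler_pM2l.
apply: (le_trans h5).
have -> : ka * (g * (4 * (g / 2) `^ (1 + a))) =
    32 * (L * M) * (ka / 4 * (g / 2) `^ (1 + a) * l).
  have -> : ka * (g * (4 * (g / 2) `^ (1 + a))) =
    8 * ka * (g / 2) * (g / 2) `^ (1 + a) by field.
  by rewrite -[in X in X * _ = _]lE; field.
apply: (@le_trans _ _ (32 * (L * M) * (2 * K0 * M ^+ 2))); last by rewrite le_eqVlt; apply/orP; left; apply/eqP; ring.
by rewrite ler_wpM2l// !mulr_ge0// ltW.
Qed.

End DeadCore.

(** * Rescaling and dead cores *)

Section Scaling.
Context {R : realType}.

(** F'''' = mu F - ka |F|^a sgn F as a chain of first order equations, which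
    spares iterated derivatives. *)
Definition ode_chain (a mu ka : R) (F F1 F2 F3 : R -> R) : Prop :=
  [/\ forall x, is_der F x (F1 x), forall x, is_der F1 x (F2 x),
      forall x, is_der F2 x (F3 x) &
      forall x, is_der F3 x (mu * F x - ka * spow a (F x))].

Lemma spowZ (a C u : R) : 0 < a -> 0 < C -> spow a (C * u) = C `^ a * spow a u.
Proof.
move=> a0 C0; rewrite /spow normrM sgrM gtr0_sg// mul1r gtr0_norm//.
by rewrite powRM// ?(ltW C0)// mulrA.
Qed.

Lemma ode_chain_affine (a mu ka c k C : R) (F F1 F2 F3 : R -> R) :
  0 < a -> 0 < C -> ode_chain a mu ka F F1 F2 F3 ->
  ode_chain a (mu * k ^+ 4) (ka * k ^+ 4 * C `^ (1 - a))
    (fun y => C * F (c + k * y)) (fun y => C * k * F1 (c + k * y))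
    (fun y => C * k ^+ 2 * F2 (c + k * y)) (fun y => C * k ^+ 3 * F3 (c + k * y)).
Proof.
move=> a0 C0 [dF dF1 dF2 dF3]; split => x.
- by apply: der_eq; [exact: der_affine (dF _)|].
- by apply: der_eq; [exact: der_affine (dF1 _)|ring].
- by apply: der_eq; [exact: der_affine (dF2 _)|ring].
apply: der_eq; [exact: der_affine (dF3 _)|].
rewrite spowZ//; have -> : C `^ (1 - a) = C / C `^ a.
  by rewrite powRB ?powRr1 ?(ltW C0)// (gt_eqF C0) implybT.
by field; rewrite gt_eqF// powR_gt0.
Qed.

Lemma cvg_ge {T} {U : set_system T} {FU : ProperFilter U} (u : T -> R) (l m : R) :
  u @ U --> l -> (\forall t \near U, m <= u t) -> m <= l.
Proof. by move=> ul H; apply: (closed_cvg (fun x => m <= x) (@closed_ge _ m) H). Qed.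

Lemma cvg_le {T} {U : set_system T} {FU : ProperFilter U} (u : T -> R) (l m : R) :
  u @ U --> l -> (\forall t \near U, u t <= m) -> l <= m.
Proof. by move=> ul H; apply: (closed_cvg (fun x => x <= m) (@closed_le _ m) H). Qed.

Lemma dead_core_local (a lam d M x0 : R) (F F1 F2 F3 : R -> R) :
  0 < a < 1 -> 0 <= lam -> 0 < d <= 1 -> 0 < M -> ode_chain a lam 1 F F1 F2 F3 ->
  (forall x, `|x - x0| <= d -> `|F x| <= M) ->
  d ^+ 4 * (`|F x0| * `|F x0| `^ (1 + a))
   <= 64 * (1000 * 100 + lam) * (2 * (1000 * 100 + lam) + 4) * M ^+ 3.
Proof.
move=> a01 lam0 /andP[d0 d1] M0 HF FM; have a0 : 0 < a by case/andP: a01.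
have [G G1 G2 G3] := ode_chain_affine x0 d a0 ltr01 HF.
have d4 : d ^+ 4 <= 1 by apply: exprn_ile1 => //; exact: ltW.
have d40 : 0 < d ^+ 4 by exact: exprn_gt0.
have mu0 : 0 <= lam * d ^+ 4 by rewrite mulr_ge0// ltW.
have ka0 : 0 < 1 * d ^+ 4 * 1 `^ (1 - a) by rewrite powR1 mul1r mulr1.
have GM x : -1 <= x <= 1 -> `|1 * F (x0 + d * x)| <= M.
  move=> hx; rewrite mul1r; apply: FM; rewrite [x0 + _]addrC addrK normrM gtr0_norm//.
  by rewrite ler_piMr ?(ltW d0)// ler_norml; lra.
have := dead_core_bound a01 mu0 ka0 G G1 G2 G3 M0 GM.
rewrite powR1 !mul1r mulr1 mulr0 addr0 => H; apply: (le_trans H).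
have mul : lam * d ^+ 4 <= lam by rewrite ler_piMr.
apply: ler_wpM2r; first by rewrite exprn_ge0// ltW.
by apply: ler_pM; lra.
Qed.

Lemma powR_root (q z : R) : 0 < q -> 0 <= z -> (z `^ q^-1) `^ q = z.
Proof. by move=> q0 z0; rewrite -powRrM mulVf ?gt_eqF// powRr1. Qed.

(** The bound of [dead_core_local] improves M to s M when the radius is halved
    from 2^-k to 2^-(k+1), provided M <= eps s^k: the factor 16 lost in d^4 at each
    step is regained by M^(1-a), as s^(1-a) = 1/16. *)
Lemma dead_core (a lam : R) (F F1 F2 F3 : R -> R) :
  0 < a < 1 -> 0 <= lam -> ode_chain a lam 1 F F1 F2 F3 ->
  exists2 eps : R, 0 < eps &
    forall c, (forall x, `|x - c| <= 1 -> `|F x| <= eps) -> F c = 0.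
Proof.
move=> a01 lam0 HF; have /andP[a0 a1] := a01.
have [K K0 loc] : exists2 K, 0 < K & forall d M x0, 0 < d <= 1 -> 0 < M ->
    (forall x, `|x - x0| <= d -> `|F x| <= M) ->
    d ^+ 4 * (`|F x0| * `|F x0| `^ (1 + a)) <= K * M ^+ 3.
  exists (64 * (1000 * 100 + lam) * (2 * (1000 * 100 + lam) + 4)).
    by apply: mulr_gt0; lra.
  by move=> d M x0 d01 M0 FM; exact: (dead_core_local a01 lam0 d01 M0 HF FM).
set q := 1 - a; have q0 : 0 < q by rewrite /q; lra.
set s : R := 16^-1 `^ q^-1.
have s0 : 0 < s by rewrite powR_gt0// invr_gt0.
have sq : s `^ q = 16^-1 by rewrite powR_root// invr_ge0.
have s1 : s < 1.
  rewrite /s [X in _ < X](_ : 1 = 1 `^ q^-1 :> R); last by rewrite powR1.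
  by apply: gt0_ltr_powR; rewrite ?invr_gt0 ?nnegrE ?invr_ge0//; lra.
(* Z is chosen so that the smallness required of M^(1-a) holds at the start. *)
clearbody s; set Z := s * s `^ (1 + a) / (16 * K).
have Z0 : 0 < Z by rewrite !(divr_gt0, mulr_gt0)// powR_gt0.
set eps := Z `^ q^-1.
have eps0 : 0 < eps by rewrite powR_gt0.
have epsq : eps `^ q = Z by rewrite powR_root// ltW.
clearbody eps; exists eps => // c Hc.
have step k : forall x, `|x - c| <= 2^-1 ^+ k -> `|F x| <= eps * s ^+ k.
  elim: k => [|k IH] x.
    by rewrite !expr0 mulr1; apply: Hc.
  move=> xc; set d : R := 2^-1 ^+ k.+1; set M := eps * s ^+ k.
  have M0 : 0 < M by rewrite mulr_gt0// exprn_gt0.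
  have d0 : 0 < d by rewrite exprn_gt0// invr_gt0.
  have d1 : 0 < d <= 1 by rewrite d0 exprn_ile1// ?invr_ge0// invf_le1 ?ler1n.
  have FM y : `|y - x| <= d -> `|F y| <= M.
    move=> yx; apply: IH; have -> : 2^-1 ^+ k = d + d :> R by rewrite /d exprS -mulrDl (_ : 2^-1 + 2^-1 = 1) ?mul1r//; field.
    by rewrite (le_trans (ler_distD x _ _))// lerD.
  have := loc _ _ _ d1 M0 FM.
  rewrite leNgt => H; rewrite leNgt; apply/negP => gt; move: H => /negP; apply.
  move: gt; rewrite (_ : eps * s ^+ k.+1 = s * M) => [gt|]; last by rewrite exprS /M; ring.
  have sM0 : 0 < s * M by rewrite mulr_gt0.
  have h1 : s * M * (s * M) `^ (1 + a) < `|F x| * `|F x| `^ (1 + a).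
    apply: ltr_pM; rewrite ?powR_ge0 ?(ltW sM0)//.
    apply: gt0_ltr_powR; rewrite ?nnegrE ?(ltW sM0)//; lra.
  apply: le_lt_trans (_ : d ^+ 4 * (s * M * (s * M) `^ (1 + a)) < _); last first.
    by rewrite ltr_pM2l// exprn_gt0.
  have Mq : M `^ q = Z * 16^-1 ^+ k.
    rewrite powRM ?(ltW eps0) ?exprn_ge0 ?(ltW s0)// epsq; congr (_ * _).
    by rewrite -powR_mulrn ?(ltW s0)// powRAC sq powR_mulrn// invr_ge0.
  have -> : M ^+ 3 = M * M `^ (1 + a) * M `^ q.
    rewrite -mulrA -powRD; last by rewrite (gt_eqF M0) implybT.
    have -> : 1 + a + q = 2%:R by rewrite /q; ring.
    by rewrite powR_mulrn ?(ltW M0)// exprS.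
  have d4 : d ^+ 4 = 16^-1 * 16^-1 ^+ k.
    have h16 : 2^-1 ^+ 4 = 16^-1 :> R by field.
    by rewrite /d -exprM mulnC exprM h16 exprS.
  rewrite Mq d4 powRM ?(ltW s0) ?(ltW M0)// /Z.
  by rewrite le_eqVlt; apply/orP; left; apply/eqP; field; rewrite gt_eqF.
have lim : (fun k => eps * s ^+ k) @ \oo --> (0 : R).
  by apply: cvg_geometric; rewrite gtr0_norm.
apply/normr0_eq0/eqP; rewrite eq_le normr_ge0 andbT.
apply: (cvg_ge lim); near=> k; apply: step.
by rewrite subrr normr0 exprn_ge0// invr_ge0.
Unshelve. all: by end_near. Qed.

End Scaling.

(** * Lattice functions and their limits along an ultrafilter *)

Section Lattice.
Context {R : realType}.
Implicit Types (w : int -> R) (k : R).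

Definition diffq k w (z : int) : R := k * (w (z + 1) - w z).

Lemma diffq_taylor k w z (m : nat) E : 0 < k ->
  (forall i, (i < m)%N -> `|diffq k w (z + i%:Z) - diffq k w z| <= E) ->
  `|w (z + m%:Z) - w z - m%:R / k * diffq k w z| <= m%:R / k * E.
Proof.
move=> k0; elim: m => [|m IH] H.
  by rewrite addr0 subrr !mul0r subrr normr0.
have {}IH := IH (fun i (im : (i < m)%N) => H i (ltnW im)).
have Hm := H m (ltnSn m).
have e1 : w (z + m.+1%:Z) = w (z + m%:Z) + k^-1 * diffq k w (z + m%:Z).
  by rewrite /diffq mulKf ?gt_eqF// (_ : z + m.+1 = z + m + 1); [ring|lia].
have -> : w (z + m.+1%:Z) - w z - m.+1%:R / k * diffq k w z =
   (w (z + m%:Z) - w z - m%:R / k * diffq k w z) + k^-1 * (diffq k w (z + m%:Z) - diffq k w z).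
  by rewrite e1 -natr1; ring.
rewrite (le_trans (ler_normD _ _))// -natr1 mulrDl mulrDl lerD//.
by rewrite normrM gtr0_norm ?invr_gt0// mul1r ler_wpM2l// invr_ge0 ltW.
Qed.

Lemma diffq_lipschitz k w z (m : nat) C : 0 < k ->
  (forall z', `|diffq k w z'| <= C) -> `|w (z + m%:Z) - w z| <= m%:R / k * C.
Proof.
move=> k0 H; elim: m => [|m IH]; first by rewrite addr0 subrr !mul0r normr0.
have -> : w (z + m.+1%:Z) - w z = (w (z + m%:Z) - w z) + k^-1 * diffq k w (z + m%:Z).
  by rewrite /diffq mulKf ?gt_eqF// (_ : z + m.+1 = z + m + 1); [ring|lia].
rewrite (le_trans (ler_normD _ _))// -natr1 mulrDl mulrDl lerD//.
by rewrite normrM gtr0_norm ?invr_gt0// mul1r ler_wpM2l// invr_ge0 ltW.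
Qed.

End Lattice.

Section UltraLimit.
Context {R : realType}.
Variables (U : set_system nat).
Context {UU : UltraFilter U}.
Hypothesis infU : forall A, (\oo : set_system nat) A -> U A.

Let UP : ProperFilter U := ultra_proper.
#[local] Existing Instance UP.

Lemma ultra_bounded_cvg (f : nat -> R) (B : R) :
  (forall j, `|f j| <= B) -> exists l : R, f @ U --> l.
Proof.
move=> fB.
have fU : (f @ U) `[(- B), B]%classic.
  rewrite /fmap/=; apply: filterE => j /=; rewrite in_itv/=.
  by have := fB j; rewrite ler_norml.
have [p [_ pc]] := segment_compact (fmap_proper_filter f UP) fU.
exists p => A pA.
have [//|nA] := @in_ultra_setVsetC _ _ (f @^-1` A) UU.
by have [y [/= nAy Ay]] := pc (~` A) A nA pA.
Qed.

Variable k : nat -> R.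
Hypothesis k0 : forall j, 0 < k j.
Hypothesis kinf : k @ \oo --> +oo.

Lemma mesh_ultra_cvgy : k @ U --> +oo.
Proof. by move=> A /kinf /infU. Qed.

Lemma mesh_step_small (e : R) : 0 < e -> \forall j \near U, (k j)^-1 <= e.
Proof.
move=> e0; have : \forall j \near U, e^-1 <= k j by move: mesh_ultra_cvgy => /cvgryPge; exact.
apply: filterS => j; rewrite -[X in _ -> _ <= X]invrK => ?.
by rewrite lef_pV2// posrE ?k0// invr_gt0.
Qed.

(** Sampling at the lattice point to the left of x makes functions on lattices
    of different meshes comparable. *)
Definition is_ulim (w : nat -> int -> R) (W : R -> R) : Prop :=
  forall x, w j (Num.floor (k j * x)) @[j --> U] --> W x.

Lemma ulim_exists (w : nat -> int -> R) (B : R -> R) :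
  (forall x j, `|w j (Num.floor (k j * x))| <= B x) -> exists W, is_ulim w W.
Proof.
move=> H; have /choice[W HW] : forall x, exists l : R,
    w j (Num.floor (k j * x)) @[j --> U] --> l.
  by move=> x; apply: (@ultra_bounded_cvg _ (B x)) => j; exact: H.
by exists W.
Qed.

Let gap j x y := `|Num.floor (k j * y) - Num.floor (k j * x)|%N.

Lemma gap_floor j x y : x <= y ->
  Num.floor (k j * y) = Num.floor (k j * x) + (gap j x y)%:Z.
Proof.
move=> xy; have : Num.floor (k j * x) <= Num.floor (k j * y).
  by apply: le_floor; rewrite ler_pM2l ?k0.
by rewrite /gap; lia.
Qed.

Lemma gap_dist j x y : x <= y ->
  `|(gap j x y)%:R / k j - (y - x)| <= (k j)^-1.
Proof.
move=> xy; have kj := k0 j.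
have gE : (gap j x y)%:R = (Num.floor (k j * y))%:~R - (Num.floor (k j * x))%:~R :> R.
  by rewrite (gap_floor j xy) rmorphD/= addrC addKr.
have /andP[a1 a2] := floor_itv (k j * x); have /andP[b1 b2] := floor_itv (k j * y).
have -> : (gap j x y)%:R / k j - (y - x) = ((gap j x y)%:R - k j * (y - x)) / k j.
  by field; rewrite gt_eqF.
have ik : 0 < (k j)^-1 by rewrite invr_gt0.
rewrite normrM (gtr0_norm ik) ler_piMl ?(ltW ik)//.
rewrite gE; move: a1 a2 b1 b2; rewrite !rmorphD/= ler_norml; lra.
Qed.

Lemma gap_le j x y : x < y -> (k j)^-1 <= y - x ->
  (gap j x y)%:R / k j <= 2 * (y - x).
Proof.
by move=> xy h; have := gap_dist j (ltW xy); rewrite ler_norml; lra.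
Qed.

Lemma gap_cvg x y : x <= y -> (gap j x y)%:R / k j @[j --> U] --> y - x.
Proof.
move=> xy; apply/cvgrPdist_le => e e0.
apply: filterS (mesh_step_small e0) => j je; rewrite distrC.
exact: le_trans (gap_dist j xy) je.
Qed.

Lemma ulim_modulus (w : nat -> int -> R) (W E : R -> R) x y :
  {homo E : s t / s <= t} ->
  (forall j z (m : nat), `|w j (z + m%:Z) - w j z| <= E (m%:R / k j)) ->
  is_ulim w W -> x < y -> `|W y - W x| <= E (2 * (y - x)).
Proof.
move=> Emono Hw HW xy.
have lim : `|w j (Num.floor (k j * y)) - w j (Num.floor (k j * x))| @[j --> U] --> `|W y - W x|.
  by apply: cvg_norm; apply: cvgB; exact: HW.
apply: (cvg_le lim).
have yx0 : 0 < y - x by rewrite subr_gt0.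
apply: filterS (mesh_step_small yx0) => j je.
rewrite (gap_floor j (ltW xy)); apply: (le_trans (Hw _ _ _)).
by apply: Emono; exact: gap_le.
Qed.

(** The first order Taylor estimate [diffq_taylor] is uniform in the mesh, so it
    passes to the pointwise limit. *)
Lemma ulim_derive (w : nat -> int -> R) (W W1 E : R -> R) :
  {homo E : s t / s <= t} ->
  (forall e, 0 < e -> exists2 d : R, 0 < d & forall t, 0 <= t <= d -> E t <= e) ->
  (forall j z (m : nat),
     `|diffq (k j) (w j) (z + m%:Z) - diffq (k j) (w j) z| <= E (m%:R / k j)) ->
  is_ulim w W -> is_ulim (fun j => diffq (k j) (w j)) W1 ->
  forall x, is_der W x (W1 x).
Proof.
move=> Emono E0 Hw HW HW1.
have fwd x y : x < y -> `|W y - W x - (y - x) * W1 x| <= (y - x) * E (2 * (y - x)).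
  move=> xy; have yx0 : 0 < y - x by rewrite subr_gt0.
  pose g j := (gap j x y)%:R / k j.
  have gc : g @ U --> y - x := gap_cvg (ltW xy).
  have lim : g j * E (2 * (y - x)) - `|w j (Num.floor (k j * y)) - w j (Num.floor (k j * x))
      - g j * diffq (k j) (w j) (Num.floor (k j * x))| @[j --> U] -->
      (y - x) * E (2 * (y - x)) - `|W y - W x - (y - x) * W1 x|.
    apply: cvgB; first by apply: cvgM => //; exact: cvg_cst.
    apply: cvg_norm; apply: cvgB; first by apply: cvgB; exact: HW.
    by apply: cvgM => //; exact: HW1.
  rewrite -subr_ge0; apply: (cvg_ge lim).
  apply: filterS (mesh_step_small yx0) => j je.
  rewrite subr_ge0 (gap_floor j (ltW xy)); apply: diffq_taylor (k0 j) _ => i im.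
  apply: (le_trans (Hw _ _ _)); apply: Emono; apply: le_trans (gap_le xy je).
  by rewrite ler_pM2r ?invr_gt0// ler_nat ltnW.
have mod1 x y : x < y -> `|W1 y - W1 x| <= E (2 * (y - x)).
  by move=> xy; exact: (ulim_modulus Emono Hw HW1 xy).
move=> x; apply: is_derive_littleo => e e0.
(* On the left of x the forward estimate holds at y, and W1 y is close to W1 x. *)
have [d d0 Hd] := E0 (e / 2) (divr_gt0 e0 (ltr0Sn _ 1)).
exists (d / 2); first by rewrite divr_gt0.
move=> y yd; have [xy|yx|->] := ltgtP x y; last by rewrite !subrr mul0r subrr normr0 mulr0.
- rewrite (@gtr0_norm _ (y - x)) ?subr_gt0// in yd *.
  apply: (le_trans (fwd _ _ xy)); rewrite [X in _ <= X]mulrC ler_pM2l ?subr_gt0//.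
  apply: (le_trans (Hd _ _)); lra.
rewrite (@ltr0_norm _ (y - x)) ?subr_lt0// opprB in yd *.
have El : E (2 * (x - y)) <= e / 2 by apply: Hd; lra.
have h1 := fwd _ _ yx; have h2 := mod1 _ _ yx.
have -> : W y - W x - (y - x) * W1 x =
  - (W x - W y - (x - y) * W1 y) + (x - y) * (W1 x - W1 y) by ring.
rewrite (le_trans (ler_normD _ _))// normrN normrM gtr0_norm ?subr_gt0//.
have xy0 : 0 < x - y by rewrite subr_gt0.
have := ler_wpM2l (ltW xy0) (le_trans h2 El).
have := ler_wpM2l (ltW xy0) El; lra.
Qed.

End UltraLimit.

(** * The continuum limit *)

Section Decay.
Context {R : realType}.

(** G is increasing and bounded, so it increases by less than eta beyond some
    x0; a point beyond x0 with |F| > eps would make G increase by eta nearby. *)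
Lemma decay_right (F F1 G : R -> R) (C eps : R) :
  0 < C -> 0 < eps -> (forall x, is_der F x (F1 x)) -> (forall x, `|F1 x| <= C) ->
  (forall x, is_der G x (F x ^+ 2)) -> (forall x, `|G x| <= 1) ->
  exists r : R, forall x, r <= x -> `|F x| <= eps.
Proof.
move=> C0 e0 dF F1C dG G1.
set l := eps / (2 * C); have l0 : 0 < l by rewrite divr_gt0// mulr_gt0.
set eta := (eps / 2) ^+ 2 * l.
have eta0 : 0 < eta by rewrite mulr_gt0// exprn_gt0// divr_gt0.
have supG : has_sup (range G).
  split; first by exists (G 0), 0.
  by exists 1 => _ [x _ <-]; apply: le_trans (ler_norm _) (G1 x).
have [_ [x0 _ <-] Gx0] := sup_adherent eta0 supG.
have Gmono x y : x <= y -> G x <= G y.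
  move=> xy; have := @le_diff_of_derive _ _ _ 0 _ _ xy dG.
  by rewrite mul0r subr_ge0; apply=> z _; exact: sqr_ge0.
exists x0 => x x0x; rewrite leNgt; apply/negP => Fx.
have xl : x <= x + l by rewrite lerDl ltW.
have Fy y : x <= y <= x + l -> (eps / 2) ^+ 2 <= F y ^+ 2.
  move=> /andP[xy yl].
  have h1 := @le_diff_of_derive _ _ _ (- C) _ _ xy dF.
  have {}h1 : - C * (y - x) <= F y - F x.
    by apply: h1 => z _; have := F1C z; rewrite ler_norml => /andP[].
  have h2 := @le_diff_of_derive _ (fun y => - 1 * F y) (fun y => - 1 * F1 y) (- C) _ _ xy.
  have {}h2 : - C * (y - x) <= - 1 * F y - - 1 * F x.
    apply: h2 => z; last by move=> _; have := F1C z; rewrite ler_norml; lra.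
    by apply: der_eq; [eapply derM; [exact: derc|exact: dF]|rewrite mulr0 addr0].
  have : C * (y - x) <= eps / 2.
    have : C * (y - x) <= C * l by rewrite ler_pM2l// lerBlDr addrC.
    have -> : C * l = eps / 2 by rewrite /l; field; rewrite gt_eqF.
    by [].
  move=> h3; have : eps / 2 <= `|F y|.
    move: Fx; have [p|p] := leP 0 (F x); have [q|q] := leP 0 (F y);
    rewrite ?(ger0_norm p) ?(ger0_norm q) ?(ltr0_norm p) ?(ltr0_norm q); lra.
  move=> h4; rewrite -(real_normK (num_real (F y))) ler_sqr ?nnegrE//.
  by rewrite divr_ge0// ltW.
have h := @le_diff_of_derive _ _ _ _ _ _ xl dG Fy.
have hs : G (x + l) <= sup (range G) by apply: (ub_le_sup supG.2); exists (x + l).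
have := Gmono _ _ x0x; move: h; rewrite [x + l]addrC addrK addrC -/eta; lra.
Qed.

Lemma decay (F F1 G : R -> R) (C eps : R) :
  0 < C -> 0 < eps -> (forall x, is_der F x (F1 x)) -> (forall x, `|F1 x| <= C) ->
  (forall x, is_der G x (F x ^+ 2)) -> (forall x, `|G x| <= 1) ->
  exists r : R, forall x, r <= `|x| -> `|F x| <= eps.
Proof.
move=> C0 e0 dF F1C dG G1.
have [r1 h1] := decay_right C0 e0 dF F1C dG G1.
have opp (f : R -> R) (m x p : R) : is_der f (- x) p ->
    is_der (fun y => m * f (0 + -1 * y)) x (m * -1 * p).
  by move=> fp; apply: der_affine; rewrite add0r mulN1r.
have [||||r2 h2] := @decay_right (fun y => 1 * F (0 + -1 * y)) (fun y => 1 * -1 * F1 (- y))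
   (fun y => -1 * G (0 + -1 * y)) C eps C0 e0.
- by move=> x; exact: opp (dF _).
- by move=> x; rewrite mul1r mulN1r normrN.
- move=> x; apply: der_eq; first exact: opp (dG _).
  by rewrite mul1r add0r mulN1r; ring.
- by move=> x; rewrite mulN1r normrN.
exists (Num.max r1 r2) => x; rewrite ge_max => /andP[].
have [x0|x0] := leP 0 x; first by rewrite (ger0_norm x0) => + _; exact: h1.
by rewrite (ltr0_norm x0) => _ /h2; rewrite mul1r add0r mulN1r opprK.
Qed.

End Decay.

Section Cumulative.
Context {R : realType}.

(** Counting negatively on the left of 0 makes this a discrete antiderivative
    on all the integers. *)
Definition signed_sum (v : int -> R) (z : int) : R :=
  match z with
  | Posz m => \sum_(i < m) v i%:Z
  | Negz m => - \sum_(i < m.+1) v (- (i%:Z + 1))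
  end.

Lemma signed_sumS v z : signed_sum v (z + 1) - signed_sum v z = v z.
Proof.
case: z => [m|[|m]].
- by rewrite -PoszD addn1 /= big_ord_recr/= addrAC subrr add0r.
- by rewrite /signed_sum (_ : Negz 0 + 1 = 0)//= big_ord0 big_ord1 sub0r opprK.
- rewrite (_ : Negz m.+1 + 1 = Negz m); last by lia.
  rewrite /signed_sum opprK [X in _ + X]big_ord_recr/= addrA addNr add0r.
  by congr v; lia.
Qed.

Lemma norm_signed_sum v (z : int) (B : R) :
  (forall z', 0 <= v z') -> (forall z' (m : nat), (m <= `|z|)%N -> \sum_(i < m) v (z' + i%:Z) <= B) ->
  `|signed_sum v z| <= B.
Proof.
move=> v0; case: z => m H; rewrite /signed_sum ?normrN ger0_norm ?sumr_ge0//.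
  by under eq_bigr => i _ do rewrite -[i%:Z]add0r; exact: H.
rewrite (reindex_inj rev_ord_inj)/=.
rewrite (eq_bigr (fun i : 'I_m.+1 => v (Negz m + i%:Z))); first by apply: H; lia.
by move=> i _; congr v; have := ltn_ord i; lia.
Qed.

End Cumulative.

Section Continuum.
Context {R : realType}.

(** The modulus of continuity of lam u - |u|^a sgn u for Lipschitz u; the maximum
    with 0 makes it monotone on the whole line. *)
Lemma modulus_small (a A B : R) : 0 < a -> 0 <= A -> 0 <= B ->
  forall e, 0 < e -> exists2 d : R, 0 < d &
    forall t, 0 <= t <= d -> A * Num.max t 0 + 2 * (B * Num.max t 0) `^ a <= e.
Proof.
move=> a0 A0 B0 e e0.
have [d d0 Hd] := powR_small a0 (divr_gt0 e0 (ltr0Sn _ 3)).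
exists (Num.min (e / (2 * (A + 1))) (d / (B + 1))).
  by rewrite lt_min !divr_gt0// ?mulr_gt0//; lra.
move=> t /andP[t0]; rewrite le_min => /andP[t1 t2]; rewrite (max_l t0).
have A1 : 0 < 2 * (A + 1) by lra. have B1 : 0 < B + 1 by lra.
rewrite ler_pdivlMr// in t1; rewrite ler_pdivlMr// in t2.
have hp : (B * t) `^ a <= e / 4 by apply: Hd; rewrite mulr_ge0//=; lra.
have := mulr_ge0 A0 t0; lra.
Qed.

Lemma modulus_mono (a A B : R) : 0 < a -> 0 <= A -> 0 <= B ->
  {homo (fun t => A * Num.max t 0 + 2 * (B * Num.max t 0) `^ a) : s t / s <= t}.
Proof.
move=> a0 A0 B0 s t st /=.
have m : Num.max s 0 <= Num.max t 0 by rewrite ge_max !le_max st lexx orbT.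
have ms : 0 <= Num.max s 0 by rewrite le_max lexx orbT.
apply: lerD; first by rewrite ler_wpM2l.
rewrite ler_pM2l//; apply: ge0_ler_powR; rewrite ?nnegrE ?mulr_ge0 ?(ltW a0)//.
- exact: le_trans m.
- by rewrite ler_wpM2l.
Qed.

(** The last hypothesis is the normalisation sum u^2 <= k on every window of
    at most k j points. In the limit it bounds an antiderivative of F^2. *)
Lemma continuum_limit (a C c : R) (k lam : nat -> R) (u : nat -> int -> R) :
  0 < a < 1 -> 0 < c -> (forall j, 1 <= k j) -> k @ \oo --> +oo ->
  (forall j z, diffq (k j) (diffq (k j) (diffq (k j) (diffq (k j) (u j)))) z =
     lam j * u j (z + 2) - spow a (u j (z + 2))) ->
  (forall j z, [/\ `|u j z| <= C, `|diffq (k j) (u j) z| <= C,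
     `|diffq (k j) (diffq (k j) (u j)) z| <= C,
     `|diffq (k j) (diffq (k j) (diffq (k j) (u j))) z| <= C &
     `|diffq (k j) (diffq (k j) (diffq (k j) (diffq (k j) (u j)))) z| <= C]) ->
  (forall j, c <= `|u j 0|) -> (forall j, c <= lam j <= C) ->
  (forall j z (m : nat), m%:R <= k j * j%:R ->
     \sum_(i < m) u j (z + i%:Z) ^+ 2 <= k j) ->
  exists (l : R) (F F1 F2 F3 : R -> R), [/\ 0 < l, ode_chain a l 1 F F1 F2 F3,
    F 0 != 0 & exists2 r : R, 0 < r & forall x, r <= `|x| -> F x = 0].
Proof.
move=> a01 c0 k1 kinf Heq Hb Hu0 Hlam Hsum.
have k0 j : 0 < k j by apply: lt_le_trans (k1 j).
have /andP[a0 a1] := a01.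
have C0 : 0 < C by have := Hlam 0; lra.
have [U [UU infU]] := @ultraFilterLemma nat \oo _.
have UP : ProperFilter U := ultra_proper.
have ex w : (forall j z, `|w j z| <= C) -> exists W, is_ulim U k w W.
  by move=> H; apply: (ulim_exists (B := fun=> C)) => x j; exact: H.
have [F HF] : exists W, is_ulim U k u W by apply: ex => j z; case: (Hb j z).
have [F1 HF1] : exists W, is_ulim U k (fun j => diffq (k j) (u j)) W.
  by apply: ex => j z; case: (Hb j z).
have [F2 HF2] : exists W, is_ulim U k (fun j => diffq (k j) (diffq (k j) (u j))) W.
  by apply: ex => j z; case: (Hb j z).
have [F3 HF3] : exists W, is_ulim U k (fun j => diffq (k j) (diffq (k j) (diffq (k j) (u j)))) W.
  by apply: ex => j z; case: (Hb j z).
have [l lamU] : exists l : R, lam @ U --> l.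
  apply: (@ultra_bounded_cvg _ _ _ _ C) => j.
  by have /andP[l1 l2] := Hlam j; rewrite ger0_norm//; lra.
have lc : c <= l by apply: (cvg_ge lamU); apply: filterE => j; case/andP: (Hlam j).
have HF4 : is_ulim U k (fun j => diffq (k j) (diffq (k j) (diffq (k j) (diffq (k j) (u j)))))
    (fun x => l * F x - spow a (F x)).
  move=> x.
  have sh : u j (Num.floor (k j * x) + 2) @[j --> U] --> F x.
    rewrite -[F x]add0r.
    have -> : (fun j => u j (Num.floor (k j * x) + 2)) =
      (fun j => (u j (Num.floor (k j * x) + 2) - u j (Num.floor (k j * x))) +
        u j (Num.floor (k j * x))) by apply/funext => j; rewrite subrK.
    apply: cvgD; last exact: HF.
    apply/cvgrPdist_le => e e0.
    have e1 : 0 < e / (2 * C) by rewrite divr_gt0// mulr_gt0.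
    apply: filterS (mesh_step_small infU k0 kinf e1) => j je.
    rewrite sub0r normrN.
    have L := @diffq_lipschitz _ (k j) (u j) (Num.floor (k j * x)) 2 C (k0 j).
    apply: (le_trans (L _)) => [z|]; first by case: (Hb j z).
    move: je; rewrite ler_pdivlMr ?mulr_gt0//; lra.
  have -> : (fun j => diffq (k j) (diffq (k j) (diffq (k j) (diffq (k j) (u j)))) (Num.floor (k j * x))) =
     (fun j => lam j * u j (Num.floor (k j * x) + 2) - spow a (u j (Num.floor (k j * x) + 2))).
    by apply/funext => j; rewrite Heq.
  apply: cvgB; first exact: cvgM.
  apply: continuous_cvg => //; apply: continuous_spow; lra.
set E := fun t : R => (C + C * C + 2 * C * C) * Num.max t 0 + 2 * (C * Num.max t 0) `^ a.
have CC : 0 < C * C by rewrite mulr_gt0.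
have A0 : 0 <= C + C * C + 2 * C * C by rewrite !addr_ge0// ?mulr_ge0// ltW.
have Emono : {homo E : s t / s <= t} by apply: modulus_mono => //; exact: ltW.
have E0 : forall e, 0 < e -> exists2 d : R, 0 < d & forall t, 0 <= t <= d -> E t <= e.
  by apply: modulus_small => //; exact: ltW.
have mk j (m : nat) : 0 <= m%:R / k j by rewrite divr_ge0// ltW.
have Elin j (m : nat) (D : R) : D <= C + C * C + 2 * C * C ->
    m%:R / k j * D <= E (m%:R / k j).
  move=> DC; rewrite /E max_l//.
  apply: (@le_trans _ _ ((C + C * C + 2 * C * C) * (m%:R / k j))).
    by rewrite mulrC ler_wpM2r.
  by rewrite lerDl mulr_ge0// powR_ge0.
have CCC : C <= C + C * C + 2 * C * C by lra.
have dF x : is_der F x (F1 x).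
  apply: (ulim_derive infU k0 kinf Emono E0 _ HF HF1) => j z m.
  apply: le_trans (Elin _ _ _ CCC).
  by apply: diffq_lipschitz => // z'; case: (Hb j z').
have dF1 x : is_der F1 x (F2 x).
  apply: (ulim_derive infU k0 kinf Emono E0 _ HF1 HF2) => j z m.
  apply: le_trans (Elin _ _ _ CCC).
  by apply: diffq_lipschitz => // z'; case: (Hb j z').
have dF2 x : is_der F2 x (F3 x).
  apply: (ulim_derive infU k0 kinf Emono E0 _ HF2 HF3) => j z m.
  apply: le_trans (Elin _ _ _ CCC).
  by apply: diffq_lipschitz => // z'; case: (Hb j z').
have uL j z (m : nat) : `|u j (z + m%:Z) - u j z| <= m%:R / k j * C.
  by apply: diffq_lipschitz => // z'; case: (Hb j z').
have dF3 x : is_der F3 x (l * F x - 1 * spow a (F x)).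
  rewrite mul1r.
  apply: (ulim_derive infU k0 kinf Emono E0 _ HF3 HF4) => j z m.
  rewrite !Heq (_ : z + m%:Z + 2 = z + 2 + m%:Z); last by lia.
  have h1 := uL j (z + 2) m.
  have h2 : `|lam j * u j (z + 2 + m%:Z) - lam j * u j (z + 2)| <= m%:R / k j * (C * C).
    rewrite -mulrBr normrM mulrCA; apply: ler_pM => //.
    by have := Hlam j => /andP[? ?]; rewrite ger0_norm//; lra.
  have h3 := @spow_hoelder _ a (u j (z + 2 + m%:Z)) (u j (z + 2)) _.
  have {}h3 : `|spow a (u j (z + 2 + m%:Z)) - spow a (u j (z + 2))| <= 2 * (C * (m%:R / k j)) `^ a.
    apply: (le_trans (h3 _)); first by lra.
    rewrite ler_pM2l//; apply: ge0_ler_powR; rewrite ?nnegrE ?(ltW a0)//.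
      by rewrite mulr_ge0// ltW.
    by rewrite mulrC.
  have -> : lam j * u j (z + 2 + m%:Z) - spow a (u j (z + 2 + m%:Z)) -
    (lam j * u j (z + 2) - spow a (u j (z + 2))) =
    (lam j * u j (z + 2 + m%:Z) - lam j * u j (z + 2)) -
    (spow a (u j (z + 2 + m%:Z)) - spow a (u j (z + 2))) by ring.
  rewrite (le_trans (ler_normB _ _))// (le_trans (lerD h2 h3))//.
  rewrite /E max_l// lerD2r mulrC ler_wpM2r//; lra.
pose S j z := (k j)^-1 * signed_sum (fun z => u j z ^+ 2) z.
have ddS j : diffq (k j) (S j) = (fun z => u j z ^+ 2).
  by apply/funext => z; rewrite /diffq /S -mulrBr signed_sumS mulVKf// gt_eqF.
have u2C j z : `|u j z ^+ 2| <= C * C.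
  by rewrite expr2 normrM; apply: ler_pM => //; case: (Hb j z).
have S00 j : S j 0 = 0 by rewrite /S /signed_sum/= big_ord0 mulr0.
have Slip j z (m : nat) : `|S j (z + m%:Z) - S j z| <= m%:R / k j * (C * C).
  by apply: diffq_lipschitz => // z'; rewrite ddS.
have floorB j x : `|Num.floor (k j * x)|%:~R <= k j * `|x| + 1 :> R.
  have /andP[f1 f2] := floor_itv (k j * x); rewrite rmorphD/= in f2.
  have kx : k j * `|x| = `|k j * x| by rewrite normrM gtr0_norm.
  rewrite kx intr_norm ler_norml; have := ler_norm (k j * x); have := ler_norm (- (k j * x)).
  rewrite normrN; lra.
have Sabs j z : `|S j z| <= `|z|%:~R / k j * (C * C).
  case: z => m.
    by have := Slip j 0 m; rewrite S00 subr0 add0r.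
  have := Slip j (Negz m) m.+1; rewrite (_ : Negz m + m.+1%:Z = 0); last by lia.
  by rewrite S00 sub0r normrN (_ : `|Negz m| = m.+1%:Z); last by lia.
have [G HG] : exists W, is_ulim U k S W.
  apply: (ulim_exists (B := fun x => (`|x| + 1) * (C * C))) => x j.
  apply: (le_trans (Sabs _ _)); rewrite ler_pM2r// ler_pdivrMr//.
  by apply: (le_trans (floorB _ _)); have := k1 j; lra.
have dG x : is_der G x (F x ^+ 2).
  apply: (ulim_derive (W1 := fun x => F x ^+ 2) infU k0 kinf Emono E0 _ HG) => [j z m|y].
    rewrite ddS subr_sqr normrM.
    apply: (@le_trans _ _ (m%:R / k j * C * (2 * C))); last first.
      by rewrite -mulrA; apply: Elin; lra.
    apply: ler_pM => //; apply: le_trans (ler_normD _ _) _.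
    have [p _ _ _ _] := Hb j (z + m%:Z); have [q _ _ _ _] := Hb j z; lra.
  rewrite (_ : (fun j => _) = (fun j => u j (Num.floor (k j * y)) ^+ 2)); last first.
    by apply/funext => j; rewrite ddS.
  by apply: cvgM; exact: HF.
have G1 x : `|G x| <= 1.
  apply: (cvg_le (cvg_norm (HG x))).
  have : U (fun j : nat => `|x| + 1 <= j%:R).
    exact: (infU _ (nbhs_infty_ger (`|x| + 1))).
  apply: filterS => j xj.
  rewrite /S normrM gtr0_norm ?invr_gt0// mulrC ler_pdivrMr// mul1r.
  apply: norm_signed_sum => [z|z m mz]; first exact: sqr_ge0.
  apply: Hsum; apply: (@le_trans _ _ (`|Num.floor (k j * x)|%:~R)).
    by move: mz; rewrite -(ler_nat R) => /le_trans; apply; rewrite -pmulrn natr_absz.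
  apply: (le_trans (floorB _ _)); have := k1 j => k1j.
  have : k j * (`|x| + 1) <= k j * j%:R by rewrite ler_pM2l.
  lra.
have F1C x : `|F1 x| <= C.
  by apply: (cvg_le (cvg_norm (HF1 x))); apply: filterE => j; case: (Hb j (Num.floor (k j * x))).
have F0 : c <= `|F 0|.
  apply: (cvg_ge (cvg_norm (HF 0))); apply: filterE => j.
  by rewrite mulr0 floor0.
have HFc : ode_chain a l 1 F F1 F2 F3 by split.
have [eps eps0 dead] : exists2 eps : R, 0 < eps &
    forall c, (forall x, `|x - c| <= 1 -> `|F x| <= eps) -> F c = 0.
  by apply: (dead_core a01 _ HFc); lra.
have [r Hr] := decay C0 eps0 dF F1C dG G1.
exists l, F, F1, F2, F3; split => //; first by lra.
  by rewrite -normr_eq0 gt_eqF//; lra.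
exists (Num.max r 0 + 1); first by rewrite ltr_wpDl// le_max lexx orbT.
move=> x rx; apply: dead => y yx; apply: Hr.
have h1 : r <= Num.max r 0 by rewrite le_max lexx.
have := ler_distD y x 0; rewrite !subr0 distrC; lra.
Qed.
End Continuum.

(** * Minimisation on a cycle *)

Lemma continuous_sumr {R : realType} {T : topologicalType} {I : finType} (g : I -> T -> R) :
  (forall i, continuous (g i)) -> continuous (fun v => \sum_i g i v).
Proof.
move=> gc; rewrite (_ : (fun v => _) = \sum_i g i); last first.
  by apply/funext => v; rewrite fct_sumE.
elim/big_ind: _ => [|f h fc hc|i _]; first exact: cst_continuous.
  by move=> x; apply: continuousD; [exact: fc|exact: hc].
exact: gc.
Qed.

Section Cycle.
Context {R : realType}.
Variables (N : nat).
Local Notation I := 'I_N.+2.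
Implicit Types (f v w : I -> R) (a K : R).

Definition fdiff f (i : I) := f (i + 1) - f i.

(** The energy J with the spacing factored out; [K] is the inverse of the mesh,
    which is also the prescribed value of the sum of the squares. *)
Definition cyc_energy a K f : R :=
  2^-1 * K ^+ 4 * (\sum_i fdiff (fdiff f) i ^+ 2) + (1 + a)^-1 * \sum_i `|f i| `^ (1 + a).

Lemma cyc_minimizer a K : 0 < a < 1 -> 0 < K ->
  exists2 f, \sum_i f i ^+ 2 = K &
    forall w, \sum_i w i ^+ 2 = K -> cyc_energy a K f <= cyc_energy a K w.
Proof.
move=> /andP[a0 a1] K0.
pose A := [set v : 'rV[R]_N.+2 | \sum_i v ord0 i ^+ 2 = K].
have coordc i : continuous (fun v : 'rV[R]_N.+2 => v ord0 i) by exact: coord_continuous.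
have Ac : continuous (fun v : 'rV[R]_N.+2 => \sum_i v ord0 i ^+ 2).
  apply: continuous_sumr => i v.
  apply: (@continuous_comp _ _ _ (fun v : 'rV[R]_N.+2 => v ord0 i) (fun x : R => x ^+ 2)).
    exact: coordc.
  exact: exprn_continuous.
have Acompact : compact A.
  pose s := Num.sqrt K.
  apply: (@subclosed_compact _ _ [set v : 'rV[R]_N.+2 | forall i, `[- s, s]%classic (v ord0 i)]).
  - rewrite (_ : A = (fun v : 'rV[R]_N.+2 => \sum_i v ord0 i ^+ 2) @^-1` [set K])//.
    have H := @preimage_closed _ _ (fun v : 'rV[R]_N.+2 => \sum_i v ord0 i ^+ 2) [set K] (fun x _ => Ac x).
    exact (H (@closed_eq _ K)).
  - exact: (@rV_compact _ N.+2 (fun=> `[- s, s]%classic) (fun=> @segment_compact R (- s) s)).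
  move=> v /= vK i; rewrite in_itv/= -ler_norml -sqrtr_sqr ler_wsqrtr// -vK.
  by rewrite (bigD1 i)//= lerDl sumr_ge0// => j _; exact: sqr_ge0.
have A0 : A !=set0.
  exists (\row_i (if i == ord0 then Num.sqrt K else 0)); rewrite /A/=.
  rewrite (bigD1 ord0)//= big1 => [|j /negbTE j0]; rewrite !mxE ?j0 ?expr0n//.
  by rewrite eqxx addr0 sqr_sqrtr// ltW.
have Jc : continuous (fun v : 'rV[R]_N.+2 => cyc_energy a K (fun i => v ord0 i)).
  have fdc i : continuous (fun v : 'rV[R]_N.+2 => v ord0 (i + 1) - v ord0 i).
    by move=> x; exact: (continuousB (@coordc (i + 1) x) (@coordc i x)).
  have J1 : continuous (fun v : 'rV[R]_N.+2 => \sum_i fdiff (fdiff (fun i => v ord0 i)) i ^+ 2).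
    apply: continuous_sumr => i x.
    apply: (@continuous_comp _ _ _ (fun v : 'rV[R]_N.+2 => fdiff (fdiff (fun i => v ord0 i)) i) (fun x : R => x ^+ 2)).
      exact: (continuousB (@fdc (i + 1) x) (@fdc i x)).
    exact: exprn_continuous.
  have J2 : continuous (fun v : 'rV[R]_N.+2 => \sum_i `|v ord0 i| `^ (1 + a)).
    apply: continuous_sumr => i x.
    apply: (@continuous_comp _ _ _ (fun v : 'rV[R]_N.+2 => v ord0 i) (fun x : R => `|x| `^ (1 + a))).
      exact: coordc.
    exact: (is_derive_cont (is_derive_abs_powR _ a0)).
  move=> x; exact: (continuousD (continuousM (@cst_continuous _ _ (2^-1 * K ^+ 4) x) (J1 x))
    (continuousM (@cst_continuous _ _ (1 + a)^-1 x) (J2 x))).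
have [c cA cmin] := EVT_min_rV A0 Acompact (continuous_subspaceT Jc).
exists (fun i => c ord0 i); first by rewrite inE in cA.
move=> w wK; have := cmin (\row_i w i); rewrite inE /A/=.
have -> : (fun i => (\row_i0 w i0) ord0 i) = w by apply/funext => i; rewrite mxE.
by apply; rewrite -wK; apply: eq_bigr => i _; rewrite mxE.
Qed.

Lemma cyc_energyZ a K f t : 0 < a < 1 -> 0 < K -> 0 <= t <= 1 ->
  cyc_energy a K (fun i => t * f i) <= cyc_energy a K f.
Proof.
move=> /andP[a0 a1] K0 /andP[t0 t1]; rewrite /cyc_energy; apply: lerD.
  apply: ler_wpM2l; first by rewrite mulr_ge0// exprn_ge0// ltW.
  apply: ler_sum => i _.
  have -> : fdiff (fdiff (fun i => t * f i)) i = t * fdiff (fdiff f) i by rewrite /fdiff; ring.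
  by rewrite exprMn ler_piMl ?sqr_ge0// exprn_ile1.
apply: ler_wpM2l; first by rewrite invr_ge0; lra.
apply: ler_sum => i _; apply: ge0_ler_powR; rewrite ?nnegrE//; first lra.
by rewrite normrM (ger0_norm t0) ler_piMl.
Qed.

(** Shrinking a function to the sphere lowers its energy. This makes f + t v
    admissible for v orthogonal to f without normalising it. *)
Lemma cyc_min_exterior a K f : 0 < a < 1 -> 0 < K ->
  (forall w, \sum_i w i ^+ 2 = K -> cyc_energy a K f <= cyc_energy a K w) ->
  forall w, K <= \sum_i w i ^+ 2 -> cyc_energy a K f <= cyc_energy a K w.
Proof.
move=> a01 K0 fmin w wK; set s := \sum_i w i ^+ 2 in wK.
have s0 : 0 < s by exact: lt_le_trans wK.
pose t := Num.sqrt (K / s).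
have t2 : t ^+ 2 = K / s by rewrite sqr_sqrtr// divr_ge0// ltW.
have t0 : 0 <= t by exact: sqrtr_ge0.
have t1 : t <= 1.
  by rewrite -(@expr_le1 _ 2)// t2 ler_pdivrMr// mul1r.
apply: le_trans (cyc_energyZ w a01 K0 (_ : 0 <= t <= 1)); last by rewrite t0.
apply: fmin; rewrite (eq_bigr (fun i => t ^+ 2 * w i ^+ 2)); last first.
  by move=> i _; rewrite exprMn.
by rewrite -mulr_sumr -/s t2 divfK// gt_eqF.
Qed.

Definition cyc_first_variation a K f v : R :=
  K ^+ 4 * (\sum_i fdiff (fdiff f) i * fdiff (fdiff v) i) + \sum_i spow a (f i) * v i.

Lemma cyc_energy_taylor a K f v t : 0 < a < 1 -> 0 < K ->
  cyc_energy a K (fun i => f i + t * v i) - cyc_energy a K f <=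
  t * cyc_first_variation a K f v + t ^+ 2 * (2^-1 * K ^+ 4 * \sum_i fdiff (fdiff v) i ^+ 2)
   + `|t| `^ (1 + a) * (4 * \sum_i `|v i| `^ (1 + a)).
Proof.
move=> /andP[a0 a1] K0.
have e1 : \sum_i fdiff (fdiff (fun i => f i + t * v i)) i ^+ 2 =
   \sum_i fdiff (fdiff f) i ^+ 2 + (2 * t * \sum_i fdiff (fdiff f) i * fdiff (fdiff v) i)
    + t ^+ 2 * \sum_i fdiff (fdiff v) i ^+ 2.
  rewrite !mulr_sumr -!big_split/=; apply: eq_bigr => i _.
  by rewrite /fdiff; ring.
have e2 : \sum_i `|f i + t * v i| `^ (1 + a) <= \sum_i `|f i| `^ (1 + a) +
    (1 + a) * t * (\sum_i spow a (f i) * v i) + `|t| `^ (1 + a) * (4 * \sum_i `|v i| `^ (1 + a)).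
  rewrite !mulr_sumr -!big_split/=; apply: ler_sum => i _.
  have ha : 0 < a <= 1 by lra.
  have := abs_powR_taylor (f i) (t * v i) ha.
  rewrite normrM powRM// ler_norml => /andP[_]; lra.
rewrite /cyc_energy e1 /cyc_first_variation.
have ia : (1 + a)^-1 * (1 + a) = 1 by rewrite mulVf// gt_eqF//; lra.
have ia0 : 0 <= (1 + a)^-1 by rewrite invr_ge0; lra.
have ia1 : (1 + a)^-1 <= 1 by rewrite invf_le1; lra.
have T0 : 0 <= `|t| `^ (1 + a) * (4 * \sum_i `|v i| `^ (1 + a)).
  by rewrite mulr_ge0 ?powR_ge0// mulr_ge0// sumr_ge0// => i _; exact: powR_ge0.
move: (ler_wpM2l ia0 e2) (ler_wpM2r T0 ia1).
move: (`|t| `^ (1 + a) * _) T0 => T T0.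
move: (\sum_i `|f i| `^ _) (\sum_i `|_ + _| `^ _) => Sf Sft.
move: (\sum_i spow _ _ * _) => L.
have eL : (1 + a)^-1 * ((1 + a) * t * L) = t * L by rewrite !mulrA ia mul1r.
lra.
Qed.

(** The linear term dominates as t tends to 0, on both sides. *)
Lemma linear_dominated a (L A B : R) : 0 < a -> 0 <= A -> 0 <= B ->
  (forall t, 0 <= t * L + t ^+ 2 * A + `|t| `^ (1 + a) * B) -> L = 0.
Proof.
move=> a0 A0 B0.
suff half L' : (forall t, 0 < t -> 0 <= t * L' + t ^+ 2 * A + `|t| `^ (1 + a) * B) -> 0 <= L'.
  move=> H; apply/eqP; rewrite eq_le; apply/andP; split; last by apply: half => t _.
  by rewrite -oppr_ge0; apply: half => t t0; have := H (- t); rewrite normrN sqrrN mulNr mulrN.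
move=> H; rewrite leNgt; apply/negP => L0.
have nL : 0 < - L' / (2 * (B + 1)) by rewrite divr_gt0 ?mulr_gt0//; lra.
have [d d0 Hd] := powR_small a0 nL.
pose t := Num.min d (- L' / (2 * (A + 1))).
have t0 : 0 < t by rewrite lt_min d0 divr_gt0 ?mulr_gt0//; lra.
have td : t `^ a <= - L' / (2 * (B + 1)) by apply: Hd; rewrite (ltW t0) ge_min lexx.
have tA : t <= - L' / (2 * (A + 1)) by rewrite ge_min lexx orbT.
rewrite ler_pdivlMr in td; last by lra.
rewrite ler_pdivlMr in tA; last by lra.
have := H _ t0; rewrite gtr0_norm// powRD ?(gt_eqF t0) ?implybT// powRr1 ?(ltW t0)//.
have -> : t * L' + t ^+ 2 * A + t * t `^ a * B = t * (L' + t * A + t `^ a * B) by ring.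
rewrite pmulr_rge0//; have := powR_gt0 a t0; lra.
Qed.

Lemma sum_delta f (j : I) : \sum_i f i * (i == j)%:R = f j.
Proof.
rewrite (bigD1 j)//= eqxx mulr1 big1 ?addr0// => i /negbTE ->.
by rewrite mulr0.
Qed.

Lemma cyc_first_variation_orthogonal a K f v : 0 < a < 1 -> 0 < K -> \sum_i f i ^+ 2 = K ->
  (forall w, \sum_i w i ^+ 2 = K -> cyc_energy a K f <= cyc_energy a K w) ->
  \sum_i f i * v i = 0 -> cyc_first_variation a K f v = 0.
Proof.
move=> a01 K0 fK fmin fv; have /andP[a0 a1] := a01.
apply: (@linear_dominated a _ (2^-1 * K ^+ 4 * \sum_i fdiff (fdiff v) i ^+ 2)
   (4 * \sum_i `|v i| `^ (1 + a)) a0).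
- apply: mulr_ge0; first by rewrite mulr_ge0// exprn_ge0// ltW.
  by apply: sumr_ge0 => i _; exact: sqr_ge0.
- by rewrite mulr_ge0// sumr_ge0// => i _; exact: powR_ge0.
move=> t; apply: le_trans (cyc_energy_taylor f v t a01 K0); rewrite subr_ge0.
apply: (cyc_min_exterior a01 K0 fmin).
have -> : \sum_i (f i + t * v i) ^+ 2 =
   \sum_i f i ^+ 2 + 2 * t * (\sum_i f i * v i) + t ^+ 2 * \sum_i v i ^+ 2.
  by rewrite !mulr_sumr -!big_split/=; apply: eq_bigr => i _; ring.
rewrite fK fv mulr0 addr0 lerDl mulr_ge0 ?sqr_ge0// sumr_ge0// => i _.
exact: sqr_ge0.
Qed.

Lemma cyc_first_variation_lin a K f v w (c : R) :
  cyc_first_variation a K f (fun i => v i - c * w i) = cyc_first_variation a K f v - c * cyc_first_variation a K f w.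
Proof.
rewrite /cyc_first_variation.
have -> : \sum_i fdiff (fdiff f) i * fdiff (fdiff (fun i => v i - c * w i)) i =
  \sum_i fdiff (fdiff f) i * fdiff (fdiff v) i - c * \sum_i fdiff (fdiff f) i * fdiff (fdiff w) i.
  by rewrite mulr_sumr -sumrB; apply: eq_bigr => i _; rewrite /fdiff; ring.
have -> : \sum_i spow a (f i) * (v i - c * w i) =
  \sum_i spow a (f i) * v i - c * \sum_i spow a (f i) * w i.
  by rewrite mulr_sumr -sumrB; apply: eq_bigr => i _; ring.
ring.
Qed.

(** The first variation vanishes on the orthogonal of f; it is evaluated at the
    projection of a Dirac mass. The shift by 2 is the price of using forward
    differences only: the adjoint of the squared forward difference looks
    backwards. *)
Lemma cyc_euler_lagrange a K f : 0 < a < 1 -> 0 < K -> \sum_i f i ^+ 2 = K ->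
  (forall w, \sum_i w i ^+ 2 = K -> cyc_energy a K f <= cyc_energy a K w) ->
  forall i, K ^+ 4 * fdiff (fdiff (fdiff (fdiff f))) i =
    cyc_first_variation a K f f / K * f (i + 1 + 1) - spow a (f (i + 1 + 1)).
Proof.
move=> a01 K0 fK fmin i; set lam := cyc_first_variation a K f f / K.
pose d (l : I) : R := (l == i + 1 + 1)%:R.
have fd_d : \sum_l f l * d l = f (i + 1 + 1) by exact: sum_delta.
pose c := f (i + 1 + 1) / K.
have ort : \sum_l f l * (d l - c * f l) = 0.
  have -> : \sum_l f l * (d l - c * f l) = \sum_l f l * d l - c * \sum_l f l ^+ 2.
    by rewrite mulr_sumr -sumrB; apply: eq_bigr => l _; ring.
  by rewrite fd_d fK /c divfK ?subrr// gt_eqF.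
have := cyc_first_variation_orthogonal a01 K0 fK fmin ort.
rewrite cyc_first_variation_lin => /eqP; rewrite subr_eq0 => /eqP.
have -> : c * cyc_first_variation a K f f = lam * f (i + 1 + 1) by rewrite /c /lam; ring.
rewrite /cyc_first_variation.
have -> : \sum_l spow a (f l) * d l = spow a (f (i + 1 + 1)) by exact: (sum_delta (fun l => spow a (f l))).
suff -> : \sum_l fdiff (fdiff f) l * fdiff (fdiff d) l = fdiff (fdiff (fdiff (fdiff f))) i by lra.
set g := fdiff (fdiff f).
have -> : \sum_l g l * fdiff (fdiff d) l = \sum_l g l * (l == i)%:R
   - 2 * (\sum_l g l * (l == i + 1)%:R) + \sum_l g l * (l == i + 1 + 1)%:R.
  rewrite mulr_sumr -sumrB -big_split/=; apply: eq_bigr => l _.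
  by rewrite /fdiff /d !(inj_eq (addIr _)); ring.
by rewrite !sum_delta /fdiff; ring.
Qed.

Lemma cyc_first_variation_le_energy a K f : 0 < a < 1 -> 0 < K ->
  \sum_i `|f i| `^ (1 + a) <= cyc_first_variation a K f f <= 2 * cyc_energy a K f.
Proof.
move=> /andP[a0 a1] K0; rewrite /cyc_first_variation /cyc_energy.
have -> : \sum_i fdiff (fdiff f) i * fdiff (fdiff f) i = \sum_i fdiff (fdiff f) i ^+ 2.
  by apply: eq_bigr => i _; rewrite expr2.
have -> : \sum_i spow a (f i) * f i = \sum_i `|f i| `^ (1 + a).
  by apply: eq_bigr => i _; rewrite spow_mulr.
have S0 : 0 <= \sum_i `|f i| `^ (1 + a) by apply: sumr_ge0 => i _; exact: powR_ge0.
have D0 : 0 <= K ^+ 4 * \sum_i fdiff (fdiff f) i ^+ 2.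
  apply: mulr_ge0; first by rewrite exprn_ge0// ltW.
  by apply: sumr_ge0 => i _; exact: sqr_ge0.
move: (\sum_i `|f i| `^ _) S0 => S S0.
have : 2^-1 <= (1 + a)^-1 by rewrite lef_pV2 ?posrE; lra.
move=> /(ler_wpM2r S0) h; apply/andP; split; lra.
Qed.

End Cycle.

(** * A test function of bounded energy *)

Section Bump.
Context {R : realType}.

Lemma sum_indicator (n m : nat) : \sum_(i < n) ((i < m)%N%:R : R) = (minn n m)%:R.
Proof.
elim: n => [|n IH]; first by rewrite big_ord0 min0n.
rewrite big_ord_recr/= IH -natrD; congr (_%:R); lia.
Qed.

Variable p : nat.
Hypothesis p0 : (0 < p)%N.
Let k := (8 * p)%N.
Let K : R := k%:R.

Let P (x : R) := 64 * (x * (1 - x)) ^+ 2.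
Let q (m : nat) : R := if (0 < m < k.+2)%N then P (m.-1%:R / K) else 0.

Lemma mesh_ge8 : 8 <= K.
Proof. by move: (p0) => h; rewrite /K ler_nat /k; lia. Qed.

Lemma profile_bounds (x : R) : 0 <= x <= 1 -> 0 <= P x <= 4.
Proof.
move=> hx; have h : 0 <= x * (1 - x) <= 4^-1.
  apply/andP; split; first by apply: mulr_ge0; lra.
  have := sqr_ge0 (x - 2^-1); rewrite sqrrB; lra.
by rewrite /P; move: (x * (1 - x)) h => t h; rewrite expr2; nra.
Qed.

Lemma frac01 (m : nat) : (m <= k)%N -> 0 <= m%:R / K <= 1.
Proof.
have K0 : 0 < K := lt_le_trans (ltr0Sn _ 7) mesh_ge8.
by move=> mk; rewrite divr_ge0 ?(ltW K0)//= ler_pdivrMr// mul1r ler_nat.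
Qed.

Lemma sampled_bounds m : 0 <= q m <= 4 * (m < k.+2)%N%:R.
Proof.
rewrite /q; case: ifP => [/andP[m1 m2]|_].
  by rewrite m2 mulr1; apply: profile_bounds; apply: frac01; lia.
by rewrite lexx mulr_ge0.
Qed.

Lemma sampled_second_difference m :
  `|K ^+ 2 * (q m.+2 - 2 * q m.+1 + q m)| <= 256 * (m < k.+2)%N%:R.
Proof.
have K8 := mesh_ge8; have K0 : 0 < K by lra.
have k8 : (8 <= k)%N by move: (p0) => h; rewrite /k; lia.
have P0 : P 0 = 0 by rewrite /P; ring.
have P1 : P 1 = 0 by rewrite /P; ring.
pose h : R := K^-1.
have h01 : 0 <= h <= 1.
  by rewrite /h invr_ge0 (ltW K0)/= invf_le1//; lra.
have Ph : 0 <= K ^+ 2 * P h <= 256.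
  have -> : K ^+ 2 * P h = 64 * (1 - h) ^+ 2 by rewrite /P /h; field; rewrite gt_eqF.
  by rewrite expr2; nra.
have Ph' : P (1 - h) = P h by rewrite /P; ring.
have [m0|m0] := posnP m.
  have -> : q m.+2 = P h by rewrite m0 /q ifT ?mul1r//; lia.
  have -> : q m.+1 = 0 by rewrite m0 /q/= mul0r P0.
  have -> : q m = 0 by rewrite m0.
  rewrite m0 mulr0 subr0 addr0 mulr1 ger0_norm; last by case/andP: Ph.
  by case/andP: Ph.
have [mk|mk] := ltnP m k.
  pose y : R := m%:R / K.
  have y01 : 0 <= y <= 1 by apply: frac01; exact: ltnW.
  have -> : q m.+2 = P (y + h).
    rewrite /q (_ : (0 < m.+2 < k.+2)%N)//= /y /h -natr1; congr P.
    by rewrite mulrDl mul1r.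
  have -> : q m.+1 = P y by rewrite /q (_ : (0 < m.+1 < k.+2)%N)//=; lia.
  have -> : q m = P (y - h).
    rewrite /q (_ : (0 < m < k.+2)%N); last lia.
    congr P; rewrite /y /h -[in RHS](prednK m0) -natr1 mulrDl mul1r addrK//.
  have -> : (m < k.+2)%N by lia.
  have -> : K ^+ 2 * (P (y + h) - 2 * P y + P (y - h)) =
     64 * (2 - 12 * (y * (1 - y)) + 2 * (h * h)).
    by rewrite /P /h; field; rewrite gt_eqF.
  have y4 : 0 <= y * (1 - y) <= 4^-1.
    apply/andP; split; first by apply: mulr_ge0; lra.
    have := sqr_ge0 (y - 2^-1); rewrite sqrrB; lra.
  have h4 : 0 <= h * h <= 1 by nra.
  by rewrite mulr1 ler_norml; lra.
have q2 : q m.+2 = 0 by rewrite /q ifF//; lia.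
have q1 : q m.+1 = 0.
  rewrite /q; case: ifP => // hm; have -> : m.+1.-1 = k by lia.
  by rewrite divff ?gt_eqF.
rewrite q1 q2 mulr0 subr0 add0r.
have [mk1|mk1] := eqVneq m k.
  have -> : q m = P (1 - h).
    rewrite /q mk1 ifT; last lia.
    by congr P; rewrite -subn1 natrB ?mulrBl ?mul1r ?divff ?gt_eqF//; lia.
  rewrite Ph' mk1 (_ : (k < k.+2)%N)// mulr1 ger0_norm; last by case/andP: Ph.
  by case/andP: Ph.
have -> : q m = 0.
  rewrite /q; case: ifP => // hm; have -> : m.-1 = k by lia.
  by rewrite divff ?gt_eqF.
by rewrite mulr0 normr0; exact: mulr_ge0 (ler0n _ _) (ler0n _ _).
Qed.

Lemma sampled_large m : (2 * p < m < 6 * p + 1)%N -> 2 <= q m ^+ 2.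
Proof.
have K8 := mesh_ge8; have K0 : 0 < K by lra.
move=> hm; rewrite /q ifT; last by rewrite /k; lia.
set x := _ / K.
have x1 : 4^-1 <= x.
  rewrite /x ler_pdivlMr// mulrC ler_pdivrMr// -natrM ler_nat /k; lia.
have x2 : x <= 3 / 4.
  rewrite /x ler_pdivrMr// mulrAC ler_pdivlMr// -!natrM ler_nat /k; lia.
have : 3 / 16 <= x * (1 - x) by nra.
rewrite /P; move: (x * (1 - x)) => t ht.
have : 9 / 256 <= t ^+ 2 by rewrite expr2; nra.
by move: (t ^+ 2) => s hs; rewrite exprMn expr2; nra.
Qed.

(** The profile 64 x^2 (1 - x)^2 on [0, 1], whose double zeros at both ends
    keep the second differences bounded. It is sampled from the second point of
    the cycle, so that wrapping around the cycle only meets zeros. *)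
Lemma cyc_bump (N : nat) (a : R) : 0 < a < 1 -> (k.+3 <= N.+2)%N ->
  exists2 w : 'I_N.+2 -> R, K <= \sum_i w i ^+ 2 &
    cyc_energy a K w <= (256 * 256 + 32) * K.
Proof.
have K8 := mesh_ge8; have K0 : 0 < K by lra.
move=> /andP[a0 a1] kN; exists (fun i => q i).
  have h i : 2 * (i < 6 * p + 1)%N%:R - 2 * (i < 2 * p + 1)%N%:R <= q i ^+ 2.
    have [h|h] := boolP (2 * p < i < 6 * p + 1)%N.
      have -> : (i < 6 * p + 1)%N = true by lia.
      have -> : (i < 2 * p + 1)%N = false by lia.
      by rewrite mulr1 mulr0 subr0; exact: sampled_large.
    apply: le_trans (sqr_ge0 (q i)); rewrite -mulrBr pmulr_rle0// subr_le0 ler_nat.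
    by move: h; case: (i < 6 * p + 1)%N / ltnP => h1; case: (i < 2 * p + 1)%N / ltnP => h2 //; lia.
  apply: le_trans (ler_sum _ (fun (i : 'I_N.+2) _ => h i)).
  rewrite sumrB -!mulr_sumr !sum_indicator.
  have -> : minn N.+2 (6 * p + 1) = (2 * p + 1 + 4 * p)%N by move: kN; rewrite /k; lia.
  have -> : minn N.+2 (2 * p + 1) = (2 * p + 1)%N by move: kN; rewrite /k; lia.
  by rewrite [in X in _ <= X]natrD /K /k (_ : (8 * p)%N = (2 * (4 * p))%N) ?natrM; [lra|lia].
have q0 : q 0 = 0 by [].
have q1 : q 1 = 0 by rewrite /q /= mul0r /P mul0r expr0n/= mulr0.
have qb m : (k.+2 <= m)%N -> q m = 0 by move=> h; rewrite /q ifF//; lia.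
have v1 (i : 'I_N.+2) : nat_of_ord (i + 1) = (i.+1 %% N.+2)%N.
  by rewrite /= modnDmr addn1.
have s1 (i : 'I_N.+2) : q (i + 1)%R = q i.+1.
  rewrite v1; have := ltn_ord i; rewrite leq_eqVlt => /orP[/eqP e|h].
    by rewrite e modnn q0 qb//; lia.
  by rewrite modn_small.
have s2 (i : 'I_N.+2) : q (i + 1 + 1)%R = q i.+2.
  rewrite s1 v1; have := ltn_ord i; rewrite leq_eqVlt => /orP[/eqP e|h].
    by rewrite e modnn q1 qb//; lia.
  by rewrite modn_small.
have dd2 (i : 'I_N.+2) : fdiff (fdiff (fun i : 'I_N.+2 => q i)) i = q i.+2 - 2 * q i.+1 + q i.
  by rewrite /fdiff s2 s1; ring.
have cnt : \sum_(i < N.+2) ((i < k.+2)%N%:R : R) <= 2 * K.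
  rewrite sum_indicator (_ : minn _ _ = k.+2); last lia.
  by rewrite -natr1 -natr1 -/K; lra.
have e1 : K ^+ 4 * \sum_i fdiff (fdiff (fun i : 'I_N.+2 => q i)) i ^+ 2 <= 256 * 256 * (2 * K).
  apply: le_trans (ler_wpM2l (mulr_ge0 (ler0n R 256) (ler0n R 256)) cnt).
  rewrite !mulr_sumr; apply: ler_sum => i _.
  have -> : K ^+ 4 * fdiff (fdiff (fun i : 'I_N.+2 => q i)) i ^+ 2 =
    `|K ^+ 2 * (q i.+2 - 2 * q i.+1 + q i)| ^+ 2.
    by rewrite real_normK ?num_real// dd2; ring.
  apply: (@le_trans _ _ ((256 * (i < k.+2)%N%:R) ^+ 2)).
    rewrite ler_sqr ?nnegrE; [exact: sampled_second_difference|exact: normr_ge0|].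
    exact: mulr_ge0 (ler0n _ _) (ler0n _ _).
  by case: (i < k.+2)%N; rewrite ?mulr0 ?mulr1 ?expr0n ?expr2.
have e2 : \sum_(i < N.+2) `|q i| `^ (1 + a) <= 16 * (2 * K).
  apply: le_trans (ler_wpM2l _ cnt) => //; rewrite !mulr_sumr; apply: ler_sum => i _.
  have /andP[h1 h2] := sampled_bounds i; rewrite ger0_norm//.
  case: (i < k.+2)%N h2 => /=; rewrite ?mulr1 ?mulr0 => h2.
    apply: (@le_trans _ _ (4 `^ (1 + a))).
      by apply: ge0_ler_powR; rewrite ?nnegrE//; lra.
    have e16 : 16 = 4 `^ 2%:R :> R by rewrite powR_mulrn// expr2; ring.
    by rewrite e16; apply: ler_powR; lra.
  have -> : q i = 0 by apply/eqP; rewrite eq_le h1 andbT; lra.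
  by rewrite powR0// gt_eqF//; lra.
have ia : 0 <= (1 + a)^-1 <= 1 by rewrite invr_ge0 invf_le1; lra.
rewrite /cyc_energy -mulrA.
have S0 : 0 <= \sum_(i < N.+2) `|q i| `^ (1 + a) by apply: sumr_ge0 => i _; exact: powR_ge0.
have /andP[_ ia1] := ia; have := ler_wpM2r S0 ia1.
move: e1 e2; set A := K ^+ 4 * _; set B := \sum_(i < N.+2) _; lra.
Qed.

End Bump.

(** * Uniform bounds for the lattice solutions *)

Section Landau.
Context {R : realType}.
Implicit Types (w : int -> R) (A B K : R).

(** Taylor expansion over m steps, that is over the length m / K. *)
Lemma diffq_bound_of_second K w A B (m : nat) : 0 < K -> (0 < m)%N ->
  (forall z, `|w z| <= A) -> (forall z, `|diffq K (diffq K w) z| <= B) ->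
  forall z, `|diffq K w z| <= 2 * A / (m%:R / K) + m%:R / K * B.
Proof.
move=> K0 m0 wA wB z; set T := m%:R / K.
have T0 : 0 < T by rewrite divr_gt0// ltr0n.
have B0 : 0 <= B by apply: le_trans (wB 0).
have h1 : `|w (z + m%:Z) - w z - T * diffq K w z| <= T * (T * B).
  apply: diffq_taylor => // i im; apply: (le_trans (diffq_lipschitz _ _ K0 wB)).
  by rewrite ler_wpM2r// ler_wpM2r ?invr_ge0 ?(ltW K0)// ler_nat ltnW.
have h2 : T * `|diffq K w z| <= 2 * A + T * (T * B).
  have -> : T * `|diffq K w z| = `|T * diffq K w z| by rewrite [RHS]normrM (gtr0_norm T0).
  have := wA (z + m%:Z); have := wA z; move: h1; rewrite !ler_norml; lra.
rewrite -(ler_pM2l T0) (_ : T * (2 * A / T + T * B) = 2 * A + T * (T * B))//.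
by field; rewrite gt_eqF.
Qed.

(** Apply the implication to the supremum. *)
Lemma bound_of_self_bound (g : int -> R) (Q B0 : R) :
  (forall z, `|g z| <= B0) ->
  (forall B, (forall z, `|g z| <= B) -> forall z, `|g z| <= B / 2 + Q) ->
  forall z, `|g z| <= 2 * Q.
Proof.
move=> gB0 H.
have supg : has_sup (range (fun z => `|g z|)).
  split; first by exists `|g 0|, 0.
  by exists B0 => _ [z _ <-].
pose s := sup (range (fun z => `|g z|)).
have gs z : `|g z| <= s by apply: (ub_le_sup supg.2); exists z.
have : s <= s / 2 + Q by apply: (ge_sup supg.1) => _ [z _ <-]; exact: H.
by move=> h z; apply: (le_trans (gs z)); lra.
Qed.

(** With lengths 1/8, 1 and 8 in [diffq_bound_of_second], a bound S2 of the
    second quotients gives back S2 / 2 + 32 A + 8 B. *)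
Lemma diffq_interpolation (p : nat) (u : int -> R) A B : (0 < p)%N ->
  let K := (8 * p)%N%:R in
  (forall z, `|u z| <= A) ->
  (forall z, `|diffq K (diffq K (diffq K (diffq K u))) z| <= B) ->
  forall z, [/\ `|diffq K u z| <= 64 * (A + B), `|diffq K (diffq K u) z| <= 64 * (A + B) &
    `|diffq K (diffq K (diffq K u)) z| <= 64 * (A + B)].
Proof.
move=> p0 K uA uB.
have pR : 0 < p%:R :> R by rewrite ltr0n.
have KE : K = 8 * p%:R by rewrite /K natrM.
have K0 : 0 < K by rewrite KE mulr_gt0.
clearbody K.
have A0 : 0 <= A by apply: le_trans (uA 0).
have B0 : 0 <= B by apply: le_trans (uB 0).
have T1 : p%:R / K = 8^-1 by rewrite KE; field; rewrite gt_eqF.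
have T2 : (8 * p)%:R / K = 1 by rewrite natrM KE divff// mulf_neq0// gt_eqF.
have T3 : (64 * p)%:R / K = 8 by rewrite natrM KE; field; rewrite gt_eqF.
have ddB w D : (forall z, `|w z| <= D) -> forall z, `|diffq K w z| <= K * (2 * D).
  move=> wD z; rewrite /diffq normrM gtr0_norm// ler_pM2l//.
  by have := wD (z + 1); have := wD z; rewrite !ler_norml; lra.
have step S2 : (forall z, `|diffq K (diffq K u) z| <= S2) ->
    (forall z, `|diffq K u z| <= 16 * A + S2 / 8) /\
    (forall z, `|diffq K (diffq K (diffq K u)) z| <= S2 / 4 + 8 * B).
  move=> h2; split=> z.
    have := diffq_bound_of_second K0 p0 uA h2 z; rewrite T1; lra.
  have p64 : (0 < 64 * p)%N by rewrite muln_gt0.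
  have := diffq_bound_of_second K0 p64 h2 uB z; rewrite T3; lra.
have D2 : forall z, `|diffq K (diffq K u) z| <= 2 * (32 * A + 8 * B).
  apply: (@bound_of_self_bound _ _ (K * (2 * (K * (2 * A))))).
    exact: (ddB _ _ (ddB _ _ uA)).
  move=> S2 h2 z; have [h1 h3] := step _ h2.
  have p8 : (0 < 8 * p)%N by rewrite muln_gt0.
  have := diffq_bound_of_second K0 p8 h1 h3 z; rewrite T2; lra.
have [h1 h3] := step _ D2.
by move=> z; split; [have := h1 z|have := D2 z|have := h3 z]; lra.
Qed.

End Landau.

Section Unroll.
Context {R : realType}.
Variables (N : nat) (f : 'I_N.+2 -> R) (i0 : 'I_N.+2).

(** Functions on cycles of various lengths become functions on one set. *)
Definition unroll (z : int) : R := f (i0 + z%:~R).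

Lemma unroll0 : unroll 0 = f i0.
Proof. by rewrite /unroll addr0. Qed.

End Unroll.

Section UnrollDifferences.
Context {R : realType}.
Variables (N : nat) (f : 'I_N.+2 -> R) (i0 : 'I_N.+2).

Lemma diffq_unroll (K : R) g z : diffq K (unroll g i0) z = K * unroll (fdiff g) i0 z :> R.
Proof. by rewrite /diffq /unroll /fdiff intrD addrA. Qed.

Lemma diffq_scale (K c : R) w z : diffq K (fun z => c * w z) z = c * diffq K w z.
Proof. by rewrite /diffq; ring. Qed.

Lemma diffq4_unroll (K : R) z :
  diffq K (diffq K (diffq K (diffq K (unroll f i0)))) z =
  K ^+ 4 * unroll (fdiff (fdiff (fdiff (fdiff f)))) i0 z.
Proof.
have e g : diffq K (unroll g i0) = (fun z => K * unroll (fdiff g) i0 z).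
  by apply/funext => z'; exact: diffq_unroll.
have e2 (c : R) g : diffq K (fun z => c * unroll g i0 z) = (fun z => c * K * unroll (fdiff g) i0 z).
  by apply/funext => z'; rewrite diffq_scale diffq_unroll mulrA.
by rewrite e !e2; ring.
Qed.

Lemma sum_unroll z (m : nat) : (m <= N.+2)%N ->
  \sum_(i < m) unroll f i0 (z + i%:Z) ^+ 2 <= \sum_i f i ^+ 2.
Proof.
move=> mN; set c := i0 + z%:~R.
have -> : \sum_i f i ^+ 2 = \sum_(i < N.+2) f (c + (i : nat)%:R) ^+ 2.
  rewrite (reindex_inj (addrI c))/=; apply: eq_bigr => i _.
  by rewrite natr_Zp.
rewrite -!(big_mkord xpredT (fun i => f (c + i%:R) ^+ 2)) (big_cat_nat (leq0n m) mN)/=.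
rewrite big_mkord (eq_bigr (fun i : 'I_m => f (c + i%:R) ^+ 2)).
  by rewrite lerDl sumr_ge0// => i _; exact: sqr_ge0.
by move=> i _; rewrite /unroll intrD addrA.
Qed.

End UnrollDifferences.

Lemma ltn_mesh_sq (p t : nat) : (0 < p)%N -> (t <= 8 * p)%N -> (t < 8 * p * (8 * p))%N.
Proof.
move=> p0 tp; apply: (@leq_trans (8 * p * 2)); first lia.
by rewrite leq_mul2l; apply/orP; right; lia.
Qed.

Section DiscreteSolutions.
Context {R : realType}.

Lemma exists_argmax (T : finType) (t0 : T) (g : T -> R) :
  exists t, forall s, g s <= g t.
Proof. by case: (@arg_maxP _ _ _ t0 xpredT g) => // t _ H; exists t => s; exact: H. Qed.

(** If S = |u 0| is the maximum and S > 1, the equation bounds the fourth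
    quotients by a multiple of S, hence so are the first ones by interpolation.
    Then |u| >= S / 2 on a fixed length and the sum of the squares bounds S. *)
Lemma discrete_sup_bound (a Lam lam : R) (p : nat) (u : int -> R) :
  0 < a < 1 -> (0 < p)%N -> 1 <= Lam -> 0 <= lam <= Lam ->
  let K := (8 * p)%N%:R in
  (forall z, diffq K (diffq K (diffq K (diffq K u))) z = lam * u (z + 2) - spow a (u (z + 2))) ->
  (forall z, `|u z| <= `|u 0|) ->
  (forall m, (m <= 8 * p * (8 * p))%N -> \sum_(i < m) u i%:Z ^+ 2 <= K) ->
  `|u 0| <= 8 * (64 * (Lam + 2)).
Proof.
move=> a01 p0 Lam1 /andP[lam0 lamL] K Heq u0 Hsum; have /andP[a0 a1] := a01.
set S := `|u 0|; set L := 64 * (Lam + 2).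
have L1 : 1 <= L by rewrite /L; lra.
have [|S1] := leP S 1; first by move=> h; rewrite (le_trans h)//; lra.
have K0 : 0 < K by rewrite ltr0n muln_gt0.
have S0 : 0 <= S by exact: normr_ge0.
have Sa : S `^ a <= S by apply: ler1_powR; exact: ltW.
have S4 z : `|diffq K (diffq K (diffq K (diffq K u))) z| <= (Lam + 1) * S.
  rewrite Heq (le_trans (ler_normB _ _))// norm_spow// normrM ger0_norm//.
  have h1 : lam * `|u (z + 2)| <= Lam * S by apply: ler_pM.
  have h2 : `|u (z + 2)| `^ a <= S `^ a.
    by apply: ge0_ler_powR; rewrite ?nnegrE ?(ltW a0)//; lra.
  lra.
have D1 z : `|diffq K u z| <= L * S.
  by have [h _ _] := diffq_interpolation p0 u0 S4 z; move: h; rewrite -/K -/S /L; lra.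
have low (i : nat) : i%:R <= K / (2 * L) -> S / 2 <= `|u i%:Z|.
  move=> iK; have := diffq_lipschitz 0 i K0 D1; rewrite add0r => h.
  have h2 : i%:R / K * (L * S) <= S / 2.
    have -> : S / 2 = (K / (2 * L)) / K * (L * S).
      by field; rewrite !gt_eqF//; lra.
    rewrite ler_wpM2r ?mulr_ge0//; try lra.
    by rewrite ler_wpM2r// invr_ge0 ltW.
  have := ler_distD (u i%:Z) (u 0) 0; rewrite !subr0 distrC -/S; lra.
have x0 : 0 <= K / (2 * L) by rewrite divr_ge0 ?(ltW K0)//; lra.
have /andP[t1 t2] := truncn_itv x0; set t := Num.truncn _ in t1 t2.
have tk : (t <= 8 * p)%N.
  rewrite -(ler_nat R) (le_trans t1)// ler_pdivrMr; last lra.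
  by rewrite -/K ler_peMr ?(ltW K0)//; lra.
have tm : (t.+1 <= 8 * p * (8 * p))%N 
  by exact: ltn_mesh_sq.
have := Hsum _ tm.
have : t.+1%:R * (S / 2) ^+ 2 <= \sum_(i < t.+1) u i%:Z ^+ 2.
  rewrite -[X in X%:R]card_ord mulr_natl -sumr_const; apply: ler_sum => i _.
  rewrite -(real_normK (num_real (u i%:Z))) ler_sqr ?nnegrE//; last by lra.
  by apply: low; apply: le_trans t1; rewrite ler_nat -ltnS ltn_ord.
have : K / (2 * L) * (S / 2) ^+ 2 <= t.+1%:R * (S / 2) ^+ 2.
  by rewrite ler_wpM2r ?sqr_ge0// ltW.
move=> h1 h2 h3.
have : K / (2 * L) * (S / 2) ^+ 2 <= K by apply: (le_trans h1); exact: (le_trans h2).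
have -> : K / (2 * L) * (S / 2) ^+ 2 = K * (S ^+ 2 / (8 * L)).
  by field; rewrite !gt_eqF//; lra.
rewrite -[X in _ <= X]mulr1 ler_pM2l// ler_pdivrMr; last lra.
have SS : S <= S ^+ 2 by rewrite expr2 ler_peMr//; lra.
by rewrite mul1r; apply: le_trans.
Qed.

Lemma sphere_lower_bound (a K S : R) (N : nat) (f : 'I_N.+2 -> R) : 0 < a < 1 ->
  (forall i, `|f i| <= S) ->
  \sum_i f i ^+ 2 <= S `^ (1 - a) * \sum_i `|f i| `^ (1 + a).
Proof.
move=> /andP[a0 a1] fS; rewrite mulr_sumr; apply: ler_sum => i _.
have [f0|f0] := eqVneq (f i) 0.
  by rewrite f0 expr0n/= mulr_ge0// powR_ge0.
have -> : f i ^+ 2 = `|f i| `^ (1 - a) * `|f i| `^ (1 + a).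
  rewrite -powRD ?normr_eq0 ?f0 ?implybT// (_ : 1 - a + (1 + a) = 2%:R); last by ring.
  by rewrite powR_mulrn// real_normK// num_real.
rewrite ler_wpM2r ?powR_ge0//; apply: ge0_ler_powR; rewrite ?nnegrE//.
- lra.
- exact: le_trans (fS i).
Qed.

(** The minimiser, recentred at a maximum of its modulus. [sphere_lower_bound]
    gives 1 <= |u 0|^(1-a) lam, which bounds |u 0| and lam below, as both are
    bounded above. *)
Lemma discrete_solutions (a : R) : 0 < a < 1 ->
  exists C c : R, 0 < c /\ forall p : nat, (0 < p)%N -> let K := (8 * p)%N%:R in
  exists (lam : R) (u : int -> R),
  [/\ forall z, diffq K (diffq K (diffq K (diffq K u))) z = lam * u (z + 2) - spow a (u (z + 2)),
      forall z, [/\ `|u z| <= C, `|diffq K u z| <= C, `|diffq K (diffq K u) z| <= C,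
        `|diffq K (diffq K (diffq K u)) z| <= C & `|diffq K (diffq K (diffq K (diffq K u))) z| <= C],
      c <= `|u 0|, c <= lam <= C &
      forall z m, (m <= 8 * p * (8 * p))%N -> \sum_(i < m) u (z + i%:Z) ^+ 2 <= K].
Proof.
move=> a01; have /andP[a0 a1] := a01.
have [Lam Lam1 bump] : exists2 Lam : R, 1 <= Lam & forall p N, (0 < p)%N ->
    ((8 * p).+3 <= N.+2)%N -> exists2 w : 'I_N.+2 -> R, (8 * p)%N%:R <= \sum_i w i ^+ 2 &
    2 * cyc_energy a (8 * p)%N%:R w <= Lam * (8 * p)%N%:R.
  exists (2 * (256 * 256 + 32)); first by lra.
  move=> p N p0 pN; have [w w1 w2] := cyc_bump p0 a01 pN.
  by exists w => //; rewrite -[X in _ <= X]mulrA ler_pM2l.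
set Cs := 8 * (64 * (Lam + 2)).
have Cs1 : 1 <= Cs by rewrite /Cs; lra.
pose C := 64 * (Cs + (Lam + 1) * Cs) + Lam.
pose c := Num.min Cs^-1 (Lam^-1 `^ (1 - a)^-1).
have Lam0 : 0 < Lam by lra.
have LC : 0 <= Lam * Cs by rewrite mulr_ge0//; lra.
have CsC : Cs <= C by rewrite /C; lra.
have LC4 : (Lam + 1) * Cs <= C by rewrite /C; lra.
have LC64 : 64 * (Cs + (Lam + 1) * Cs) <= C by rewrite /C; lra.
exists C, c; split.
  by rewrite lt_min invr_gt0 powR_gt0 ?invr_gt0// andbT; lra.
move=> p p0 K; pose N := (8 * p * (8 * p))%N.
have K0 : 0 < K by rewrite ltr0n muln_gt0.
have [f fK fmin] := @cyc_minimizer R N a K a01 K0.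
have [i0 Hi0] := @exists_argmax _ (ord0 : 'I_N.+2) (fun i => `|f i|).
set lam := cyc_first_variation a K f f / K; set u := unroll f i0.
have /andP[v1 v2] := cyc_first_variation_le_energy f a01 K0.
have lamK : cyc_first_variation a K f f = lam * K by rewrite /lam divfK// gt_eqF.
have lamL : lam <= Lam.
  have pN : ((8 * p).+3 <= N.+2)%N.
    by rewrite !ltnS; exact: ltn_mesh_sq.
  have [w w1 w2] := bump p N p0 pN.
  rewrite -(ler_pM2r K0) -lamK (le_trans v2)// (le_trans _ w2)// ler_pM2l//.
  exact: (cyc_min_exterior a01 K0 fmin).
have lam0 : 0 <= lam.
  apply: divr_ge0; last exact: ltW.
  by apply: le_trans v1; apply: sumr_ge0 => i _; exact: powR_ge0.
have u0E : u 0 = f i0 by exact: unroll0.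
have u0 z : `|u z| <= `|u 0| by rewrite u0E; exact: Hi0.
have Heq z : diffq K (diffq K (diffq K (diffq K u))) z = lam * u (z + 2) - spow a (u (z + 2)).
  rewrite diffq4_unroll /unroll (cyc_euler_lagrange a01 K0 fK fmin) -/lam /u /unroll.
  by rewrite (_ : z + 2 = z + 1 + 1) -?addrA// !intrD !addrA.
have Hsum z m : (m <= N)%N -> \sum_(i < m) u (z + i%:Z) ^+ 2 <= K.
  by move=> mN; rewrite -fK; apply: sum_unroll; exact: leq_trans (leqW (leqnSn N)).
have S0 : `|u 0| <= Cs.
  apply: (@discrete_sup_bound a Lam lam p u a01 p0 Lam1) => //; first by rewrite lam0.
  by move=> m mN; under eq_bigr => i _ do rewrite -[i%:Z]add0r; exact: Hsum.
have uC z : `|u z| <= Cs by exact: le_trans (u0 z) S0.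
have D4 z : `|diffq K (diffq K (diffq K (diffq K u))) z| <= (Lam + 1) * Cs.
  rewrite Heq (le_trans (ler_normB _ _))// norm_spow// normrM ger0_norm//.
  have h1 : lam * `|u (z + 2)| <= Lam * Cs by apply: ler_pM.
  have h2 : `|u (z + 2)| `^ a <= Cs `^ a.
    by apply: ge0_ler_powR; rewrite ?nnegrE ?(ltW a0)//; lra.
  have h3 : Cs `^ a <= Cs by apply: ler1_powR => //; exact: ltW.
  lra.
have key : 1 <= `|u 0| `^ (1 - a) * lam.
  rewrite -(ler_pM2r K0) mul1r -mulrA -lamK -{1}fK u0E.
  apply: (le_trans (@sphere_lower_bound a K _ N f a01 Hi0)).
  by rewrite ler_wpM2l ?powR_ge0.
have uS : 0 < `|u 0|.
  rewrite lt_neqAle normr_ge0 andbT; apply/eqP => h; move: key.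
  by rewrite -h powR0 ?mul0r ?ler10// gt_eqF//; lra.
exists lam, u; split => //.
- move=> z; have [d1 d2 d3] := diffq_interpolation p0 uC D4 z.
  split; [exact: le_trans (uC z) CsC|exact: le_trans d1 LC64|exact: le_trans d2 LC64|
    exact: le_trans d3 LC64|exact: le_trans (D4 z) LC4].
- apply: (@le_trans _ _ (Lam^-1 `^ (1 - a)^-1)); first by rewrite ge_min lexx orbT.
  rewrite leNgt; apply/negP => h.
  have : `|u 0| `^ (1 - a) < Lam^-1.
    have -> : Lam^-1 = (Lam^-1 `^ (1 - a)^-1) `^ (1 - a).
      by rewrite powR_root ?invr_ge0//; lra.
    by apply: gt0_ltr_powR; rewrite ?nnegrE ?powR_ge0//; lra.
  rewrite -(ltr_pM2r Lam0) mulVf ?gt_eqF// => h2.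
  have : `|u 0| `^ (1 - a) * lam <= `|u 0| `^ (1 - a) * Lam by rewrite ler_wpM2l ?powR_ge0.
  lra.
- apply/andP; split; last by rewrite /C; lra.
  apply: (@le_trans _ _ Cs^-1); first by rewrite ge_min lexx.
  have Cs0 : 0 < Cs by lra.
  rewrite -(ler_pM2l Cs0) mulfV ?gt_eqF// (le_trans key)// ler_wpM2r//.
  apply: (@le_trans _ _ (Cs `^ (1 - a))).
    by apply: ge0_ler_powR; rewrite ?nnegrE//; lra.
  by apply: ler1_powR => //; lra.
Qed.

End DiscreteSolutions.

(** * A solution with compact support *)

Section CompactSolution.
Context {R : realType}.

Lemma compact_solution_lam (a : R) : 0 < a < 1 ->
  exists (l : R) (F F1 F2 F3 : R -> R), [/\ 0 < l, ode_chain a l 1 F F1 F2 F3,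
    F 0 != 0 & exists2 r : R, 0 < r & forall x, r <= `|x| -> F x = 0].
Proof.
move=> a01; have [C [c [c0 H]]] := discrete_solutions a01.
have /choice[lu Hlu] : forall j : nat, exists lu : R * (int -> R),
  let K := (8 * j.+1)%N%:R in let lam := lu.1 in let u := lu.2 in
  [/\ forall z, diffq K (diffq K (diffq K (diffq K u))) z = lam * u (z + 2) - spow a (u (z + 2)),
      forall z, [/\ `|u z| <= C, `|diffq K u z| <= C, `|diffq K (diffq K u) z| <= C,
        `|diffq K (diffq K (diffq K u)) z| <= C & `|diffq K (diffq K (diffq K (diffq K u))) z| <= C],
      c <= `|u 0|, c <= lam <= C &
      forall z m, (m <= 8 * j.+1 * (8 * j.+1))%N -> \sum_(i < m) u (z + i%:Z) ^+ 2 <= K].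
  by move=> j; have [lam [u Hu]] := H j.+1 (ltn0Sn j); exists (lam, u).
apply: (@continuum_limit _ a C c (fun j => (8 * j.+1)%N%:R) (fun j => (lu j).1)
  (fun j => (lu j).2)) => //.
- by move=> j; rewrite ler1n muln_gt0.
- apply/cvgryPge => A; have := nbhs_infty_ger A; apply: filterS => j /= Aj.
  by rewrite (le_trans Aj)// ler_nat; lia.
- by move=> j; case: (Hlu j).
- by move=> j; case: (Hlu j).
- by move=> j; case: (Hlu j).
- by move=> j; case: (Hlu j).
move=> j z m mk; have [_ _ _ _ Hs] := Hlu j; apply: Hs.
rewrite -natrM ler_nat in mk; apply: (leq_trans mk).
by rewrite leq_mul2l; apply/orP; right; lia.
Qed.

(** The dilation y |-> l^(-1/4) y sets the linear coefficient to 1, then the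
    amplitude l^(1/(1-a)) sets that of the absorption term to 1. *)
Lemma compact_solution (a : R) : 0 < a < 1 ->
  exists (F F1 F2 F3 : R -> R), [/\ ode_chain a 1 1 F F1 F2 F3,
    F 0 != 0 & exists2 r : R, 0 < r & forall x, r <= `|x| -> F x = 0].
Proof.
move=> a01; have /andP[a0 a1] := a01.
have [l [F [F1 [F2 [F3 [l0 HF F0 [r r0 Hr]]]]]]] := compact_solution_lam a01.
pose k := l^-1 `^ 4^-1; pose C := l `^ (1 - a)^-1.
have k0 : 0 < k by rewrite powR_gt0// invr_gt0.
have C0 : 0 < C by exact: powR_gt0.
have k4 : k ^+ 4 = l^-1.
  by rewrite -powR_mulrn ?(ltW k0)// /k powR_root// invr_ge0 ltW.
have Ca : C `^ (1 - a) = l by rewrite /C powR_root ?(ltW l0)//; lra.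
have := ode_chain_affine 0 k a0 C0 HF; rewrite k4 Ca mul1r mulfV ?mulVf ?gt_eqF// => H.
exists (fun y => C * F (0 + k * y)), (fun y => C * k * F1 (0 + k * y)),
  (fun y => C * k ^+ 2 * F2 (0 + k * y)), (fun y => C * k ^+ 3 * F3 (0 + k * y)).
split => //; first by rewrite mulr0 addr0 mulf_neq0// gt_eqF.
exists (r / k); first by rewrite divr_gt0.
move=> x rx; rewrite Hr ?mulr0// add0r normrM gtr0_norm//.
by rewrite -ler_pdivrMl// mulrC.
Qed.

Lemma der_vanish (F F1 : R -> R) (r : R) :
  (forall x, is_der F x (F1 x)) -> (forall x, r < `|x| -> F x = 0) ->
  forall x, r < `|x| -> F1 x = 0.
Proof.
move=> dF Fr x rx.
have d0 : is_der F x 0.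
  have near0 : nbhs x (fun y => 0 = F y).
    apply: (@filterS _ (nbhs x) _ (fun y => r < `|y|)); first by move=> y /Fr ->.
    have := cvgr_gt _ (@norm_continuous _ _ x) _ rx; exact.
  exact: near_eq_is_derive near0 (derc x 0).
have := dF x; rewrite /is_der => h1.
by rewrite -(@derive_val _ _ _ _ _ _ _ h1) (@derive_val _ _ _ _ _ _ _ d0).
Qed.

End CompactSolution.

(** * Test functions approximating an indicator *)

Section TestFunctions.
Context {R : realType}.
Implicit Types (x a b m : R).

(** The square makes the positive part continuously differentiable. *)
Definition sqpos (t : R) : R := Num.max t 0 ^+ 2.

Lemma is_der_sqpos t : is_der sqpos t (2 * Num.max t 0).
Proof.
apply: is_derive_littleo => e e0; exists e => // y yt.
rewrite /sqpos (@le_trans _ _ (`|y - t| * `|y - t|)) ?ler_wpM2r ?(ltW yt)//.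
rewrite -normrM -expr2 (ger0_norm (sqr_ge0 _)).
have [t0|t0] := leP t 0; have [y0|y0] := leP y 0;
  have := sqr_ge0 (y - t); rewrite ler_norml => h; apply/andP; split; nra.
Qed.

Lemma continuous_maxr0 : continuous (fun t : R => Num.max t 0).
Proof.
move=> t; apply/cvgrPdist_le => e e0; near=> y.
have : `|t - y| <= e by near: y; exact: cvgr_dist_le.
have [t0|t0] := leP t 0; have [y0|y0] := leP y 0; rewrite !ler_norml; lra.
Unshelve. all: by end_near. Qed.

Definition bump0 a b x : R := sqpos (x - a) * sqpos (b - x).
Definition bump0' a b x : R :=
  sqpos (x - a) * - (2 * Num.max (b - x) 0) + sqpos (b - x) * (2 * Num.max (x - a) 0).
(** These functions increase to the indicator of ]a, b[ as m grows. *)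
Definition bump a b m x : R := 1 - (1 + m * bump0 a b x)^-1.

Lemma bump0_ge0 a b x : 0 <= bump0 a b x.
Proof. by rewrite /bump0 mulr_ge0// sqr_ge0. Qed.

Lemma bump_den a b m x : 0 <= m -> 1 <= 1 + m * bump0 a b x.
Proof. by move=> m0; rewrite lerDl mulr_ge0// bump0_ge0. Qed.

Lemma bump01 a b m x : 0 <= m -> 0 <= bump a b m x <= 1.
Proof.
move=> m0; have h := bump_den a b x m0; have h0 : 0 < 1 + m * bump0 a b x by lra.
rewrite /bump subr_ge0 invf_le1// h/= lerBlDr lerDl invr_ge0; lra.
Qed.

Lemma bump0_eq0 a b x : (bump0 a b x == 0) = (x \notin `]a, b[).
Proof.
rewrite /bump0 mulf_eq0 !sqrf_eq0 in_itv/= negb_and -!leNgt.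
by congr orb; apply/idP/idP; rewrite eq_le ge_max le_max lexx orbT andbT; lra.
Qed.

Lemma is_der_bump0 a b x : is_der (bump0 a b) x (bump0' a b x).
Proof.
apply: derM.
  have h : is_der (fun y : R => y - a) x 1.
    by apply: der_eq; [eapply derB; [exact: derid|exact: derc]|rewrite subr0].
  by apply: der_eq; [exact (@der_comp _ sqpos (fun y => y - a) x _ _ (is_der_sqpos _) h)|rewrite mulr1].
have h : is_der (fun y : R => b - y) x (- 1).
  by apply: der_eq; [eapply derB; [exact: derc|exact: derid]|rewrite sub0r].
by apply: der_eq; [exact (@der_comp _ sqpos (fun y => b - y) x _ _ (is_der_sqpos _) h)|rewrite mulrN1].
Qed.

Lemma is_der_bump a b m x : 0 <= m ->
  is_der (bump a b m) x (m * bump0' a b x * (1 + m * bump0 a b x) ^- 2).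
Proof.
move=> m0; have h := bump_den a b x m0.
have d : is_der (fun y => 1 + m * bump0 a b y) x (m * bump0' a b x).
  apply: der_eq; first by eapply derD; [exact: derc|eapply derM; [exact: derc|exact: is_der_bump0]].
  by rewrite mulr0 addr0 add0r.
have d0 : 1 + m * bump0 a b x != 0 by rewrite gt_eqF//; lra.
apply: der_eq; first by eapply derB; [exact: derc|exact (@is_deriveV R (fun y => 1 + m * bump0 a b y) x _ _ d0 d)].
by rewrite sub0r /GRing.scale/= mulNr opprK mulrC.
Qed.

Lemma bump_test_fun r a b m : 0 <= m -> - r < a -> b < r -> 0 < r ->
  test_fun r (bump a b m).
Proof.
move=> m0 ra br r0.
have sq_cont : continuous (sqpos : R -> R).
  by move=> x; exact: (is_derive_cont (is_der_sqpos x)).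
have b0_cont : continuous (bump0 a b).
  by move=> x; exact: (is_derive_cont (is_der_bump0 a b x)).
have dE : derive1 (bump a b m) = (fun x => m * bump0' a b x * (1 + m * bump0 a b x) ^- 2).
  apply/funext => x; rewrite derive1E.
  exact: (@derive_val _ _ _ _ _ _ _ (is_der_bump a b x m0)).
split.
- by move=> x; have [] := is_der_bump a b x m0.
- rewrite dE => x; apply: cvgM.
    apply: cvgM; first exact: cvg_cst.
    have ca : y - a @[y --> x] --> x - a by apply: cvgB => //; exact: cvg_cst.
    have cb : b - y @[y --> x] --> b - x by apply: cvgB => //; exact: cvg_cst.
    apply: cvgD; apply: cvgM.
    + exact: (continuous_cvg _ (@sq_cont _) ca).
    + apply: cvgN; apply: cvgM; first exact: cvg_cst.
      exact: (continuous_cvg _ (@continuous_maxr0 _) cb).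
    + exact: (continuous_cvg _ (@sq_cont _) cb).
    + apply: cvgM; first exact: cvg_cst.
      exact: (continuous_cvg _ (@continuous_maxr0 _) ca).
  apply: cvgV; first by rewrite expf_neq0// gt_eqF//; have := bump_den a b x m0; lra.
  have c1 : 1 + m * bump0 a b y @[y --> x] --> 1 + m * bump0 a b x.
    by apply: cvgD; [exact: cvg_cst|apply: cvgM; [exact: cvg_cst|exact: b0_cont]].
  exact: (continuous_cvg _ (@exprn_continuous _ 2 _) c1).
exists (Num.max 0 (Num.max (- a) b)); first by rewrite !gt_max; apply/and3P; split; lra.
move=> x; rewrite !ge_max => /and3P[_ ax bx].
have : bump0 a b x == 0.
  rewrite bump0_eq0 in_itv/= negb_and -!leNgt.
  have [x0|x0] := leP 0 x.
    by rewrite ger0_norm// in bx; rewrite bx orbT.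
  by rewrite ltr0_norm// lerN2 in ax; rewrite ax.
by move=> /eqP h; rewrite /bump h mulr0 addr0 invr1 subrr.
Qed.

Lemma bump_cvg a b x : bump a b n%:R x @[n --> \oo] --> (\1_(`]a, b[%classic) x : R).
Proof.
have [xab|xab] := boolP (x \in `]a, b[).
  have q0 : 0 < bump0 a b x.
    by rewrite lt_neqAle bump0_ge0 eq_sym bump0_eq0 xab.
  rewrite indicE mem_set//= -[1 in X in _ --> X]subr0.
  apply: cvgB; first exact: cvg_cst.
  apply/gtr0_cvgV0.
    by apply: nearW => n; have := @bump_den a b n%:R x (ler0n _ _); lra.
  apply/cvgryPge => A; near=> n.
  have : A / bump0 a b x <= n%:R by near: n; exact: nbhs_infty_ger.
  by rewrite ler_pdivrMr//; lra.
have q0 : bump0 a b x = 0 by apply/eqP; rewrite bump0_eq0.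
rewrite indicE memNset; last by move/negP: xab.
rewrite (_ : (fun n => _) = cst 0); first exact: cvg_cst.
by apply/funext => n; rewrite /bump q0 mulr0 addr0 invr1 subrr.
Unshelve. all: by end_near. Qed.

End TestFunctions.

(** * The fundamental lemma of the calculus of variations *)

Section L2.
Context {R : realType}.
Notation mu := (@lebesgue_measure R).
Implicit Types (r : R) (f g : R -> R).

Lemma measurable_Bset r : measurable (Bset r : set (measurableTypeR R)).
Proof. exact: measurable_itv. Qed.
#[local] Hint Resolve measurable_Bset : core.

Lemma Bset_finite r : (mu (Bset r) < +oo)%E.
Proof. by rewrite lebesgue_measure_itv/=; case: ifP => _; rewrite ?ltry. Qed.

Lemma restrictM (D : set R) f g : (f \_ D) \* (g \_ D) = (fun x => f x * g x) \_ D.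
Proof.
by apply/funext => x; rewrite /= !patchE; case: ifP => // _; rewrite mulr0.
Qed.

Lemma inL2_measurable r f : inL2 r f -> measurable_fun (Bset r) f.
Proof.
move=> /sub_Lfun_mfun; rewrite inE/= => mf.
exact: ((measurable_restrictT _ (measurable_Bset r)).2 mf).
Qed.

Lemma inL2_integrableM r f g : inL2 r f -> inL2 r g ->
  mu.-integrable (Bset r) (EFin \o (fun x => f x * g x)).
Proof.
move=> f2 g2; have /Lfun1_integrable := Lfun2_mul_Lfun1 f2 g2.
rewrite restrictM -restrict_EFin => h.
by apply/integrable_mkcond => //; exact: measurable_Bset.
Qed.

Lemma inL2_integrable_sqr r f : inL2 r f ->
  mu.-integrable (Bset r) (EFin \o (fun x => f x ^+ 2)).
Proof.
by move=> f2; have := inL2_integrableM f2 f2; congr (mu.-integrable _ (EFin \o _)).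
Qed.

Lemma inL2D r f g : inL2 r f -> inL2 r g -> inL2 r (f \+ g).
Proof.
move=> f2 g2; rewrite /inL2 (_ : (f \+ g) \_ _ = f \_ (Bset r) + g \_ (Bset r)).
  exact: (Lfun_addr_closed mu (lee1n 2)).2.
by apply/funext => x; rewrite /GRing.add/= !patchE; case: ifP => // _; rewrite addr0.
Qed.

Lemma inL2_integrable_sqrP r f : measurable_fun (Bset r) f ->
  mu.-integrable (Bset r) (EFin \o (fun x => f x ^+ 2)) -> inL2 r f.
Proof.
move=> mf fi; rewrite /inL2 inE; apply/andP; split; rewrite inE/=.
  exact: ((measurable_restrictT _ (measurable_Bset r)).1 mf).
apply: (@lty_poweRy _ _ 2) => //; rewrite powR_Lnorm//.
have /integrableP[_] := (integrable_mkcond _ (measurable_Bset r)).1 fi.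
apply: le_lt_trans.
rewrite le_eqVlt; apply/orP; left; apply/eqP; apply: eq_integral => x _.
rewrite restrict_EFin /= !patchE; case: ifP => _.
  by rewrite (powR_mulrn 2)// real_normK ?num_real// ger0_norm// sqr_ge0.
by rewrite normr0 powR0.
Qed.

Lemma continuous_bounded_itv f r : continuous f -> exists C : R, forall x, Bset r x -> `|f x| <= C.
Proof.
move=> cf; have [r0|r0] := leP 0 r; last first.
  by exists 0 => x; rewrite /Bset/= in_itv/=; lra.
have cn : {within `[(- r), r], continuous (fun x => `|f x|)}.
  apply: continuous_subspaceT => x; apply: cvg_norm; exact: cf.
have rr : - r <= r by lra.
have [c _ Hc] := EVT_max rr cn; exists `|f c| => x.
by rewrite /Bset/= in_itv/= => hx; apply: Hc; rewrite in_itv/=; lra.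
Qed.

Lemma inL2_continuous r f : continuous f -> inL2 r f.
Proof.
move=> cf; apply: inL2_integrable_sqrP.
  by apply: measurable_funTS; exact: continuous_measurable_fun.
have [C HC] := @continuous_bounded_itv (fun x => f x ^+ 2) r
  (fun x => continuous_cvg _ (@exprn_continuous _ 2 _) (cf x)).
apply: measurable_bounded_integrable => //; first exact: Bset_finite.
  apply: measurable_funTS; apply: continuous_measurable_fun => x.
  exact: continuous_cvg _ (@exprn_continuous _ 2 _) (cf x).
exists C; split; first exact: num_real.
by move=> M CM x /HC /le_trans; apply; exact: ltW.
Qed.

Lemma eq_ae_Bint r f g : measurable_fun (Bset r) f -> measurable_fun (Bset r) g ->
  {ae mu, forall x, Bset r x -> f x = g x} -> Bint r f = Bint r g.
Proof.
move=> mf mg fg; congr fine; apply: ae_eq_integral => //; try exact/measurable_EFinP.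
by apply: (@filterS _ _ (ae_filter_ringOfSetsType mu)) fg => x /= h xB; rewrite h.
Qed.

(** Testing against bumps shows that the primitive of d is constant, and the
    Lebesgue differentiation theorem recovers d from its primitive. *)
Lemma fundamental_lemma r d : 0 < r -> inL2 r d ->
  (forall phi, test_fun r phi -> Bint r (fun x => d x * phi x) = 0) ->
  {ae mu, forall x, Bset r x -> d x = 0}.
Proof.
move=> r0 d2 H; pose D := d \_ (Bset r).
have iB : mu.-integrable (Bset r) (EFin \o d).
  have := inL2_integrableM d2 (@inL2_continuous r (fun=> 1) (@cst_continuous _ _ _)).
  by rewrite (_ : (fun x => d x * 1) = d)//; apply/funext => x; rewrite mulr1.
have iD : mu.-integrable setT (EFin \o D).
  by rewrite /D -restrict_EFin; apply/(integrable_mkcond _ (measurable_Bset r)).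
have mD : measurable_fun setT D by apply/measurable_EFinP; exact: (measurable_int mu iD).
have zero a b : - r < a -> a < b -> b < r -> Rintegral mu `]a, b] D = 0.
  move=> ra ab br.
  have mb n : measurable_fun setT (bump a b n%:R).
    apply: continuous_measurable_fun => x.
    exact: (is_derive_cont (is_der_bump a b x (ler0n _ n))).
  have mf n : measurable_fun setT (fun x => (D x * bump a b n%:R x)%:E).
    by apply/measurable_EFinP; exact: measurable_funM.
  have ml : measurable_fun setT (fun x => (D x * \1_(`]a, b[%classic) x)%:E).
    by apply/measurable_EFinP; apply: measurable_funM => //; exact: measurable_indic.
  have cvgD : {ae mu, forall x, setT x -> (D x * bump a b n%:R x)%:E @[n --> \oo] -->
      (D x * \1_(`]a, b[%classic) x)%:E}.
    apply: aeW => x _; apply: cvg_EFin; first by apply: nearW.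
    by apply: cvgM; [exact: cvg_cst|exact: bump_cvg].
  have domD : {ae mu, forall x (n : nat), setT x ->
      (`|(D x * bump a b n%:R x)%:E| <= `|D x|%:E)%E}.
    apply: aeW => x n _; rewrite lee_fin normrM ler_piMr//.
    by have /andP[h1 h2] := bump01 a b x (ler0n R n); rewrite ger0_norm.
  have inD : mu.-integrable setT (fun x => `|D x|%:E) by exact: integrable_norm iD.
  have [_ _] := @dominated_convergence _ (measurableTypeR R) R mu setT measurableT
    _ _ _ mf ml cvgD inD domD.
  have z n : (\int[mu]_x (D x * bump a b n%:R x)%:E = 0)%E.
    have tb := bump_test_fun (ler0n R n) ra br r0.
    have := H _ tb; rewrite /Bint /Rintegral.
    have ib : mu.-integrable (Bset r) (EFin \o (fun x => d x * bump a b n%:R x)).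
      apply: inL2_integrableM => //; apply: inL2_continuous => x.
      exact: (is_derive_cont (is_der_bump a b x (ler0n _ n))).
    move=> h; have : (\int[mu]_(x in Bset r) (d x * bump a b n%:R x)%:E = 0)%E.
      by rewrite -[LHS]fineK ?h//; exact: integrable_fin_num.
    rewrite integral_mkcond => h0; rewrite -[RHS]h0; apply: eq_integral => x _.
    by rewrite /D !patchE; case: ifP => // _; rewrite mul0r.
  rewrite (_ : [sequence _]_n = cst 0%E); last by apply/funext => n; exact: z.
  move=> /cvg_lim => /(_ (@ereal_hausdorff R)); rewrite lim_cst// => h.
  rewrite -Rintegral_itv_bndo_bndc; last first.
    by apply: integrableS iD => //; exact: measurable_itv.
  rewrite /Rintegral integral_mkcond (_ : (\int[mu]_x _ = 0)%E)//.
  rewrite [RHS]h; apply: eq_integral => x _.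
  by rewrite patchE indicE; case: ifP => _; rewrite ?mulr1 ?mulr0.
pose P x := Rintegral mu `]-oo, x] D.
have iDy (y : R) : mu.-integrable `]-oo, y] (EFin \o D).
  by apply: integrableS iD => //; exact: measurable_itv.
have Pc x y : - r < x -> x < y -> y < r -> P y = P x.
  move=> rx xy yr; apply/eqP; rewrite -subr_eq0; apply/eqP.
  rewrite /P Rintegral_itvB//; last by rewrite bnd_simp ltW.
  exact: zero.
have := FTC1Ny iDy (integrable_locally (measurable_Bset r) iB).
apply: (@filterS _ _ (ae_filter_ringOfSetsType mu)) => x [dP PD] xB; move: (xB); rewrite /Bset/= in_itv/= => /andP[x1 x2].
have Pconst : nbhs x (fun y => P x = P y).
  apply: (@nbhs_interval _ _ _ (- r)%:E r%:E); rewrite ?lte_fin// => y.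
  rewrite !lte_fin => y1 y2; have [xy|yx|-> //] := ltgtP x y.
    by rewrite (Pc x y).
  by rewrite (Pc y x).
have d0 : is_derive x 1 P 0 := near_eq_is_derive Pconst (derc x (P x)).
move: PD; rewrite derive1E (@derive_val _ _ _ _ _ _ _ d0) /D patchE mem_set//.
Qed.

End L2.

(** * Weak derivatives *)

Section WeakDerivative.
Context {R : realType}.
Notation mu := (@lebesgue_measure R).
Implicit Types (r : R) (f g : R -> R).

Lemma inL2N r f : inL2 r f -> inL2 r (\- f).
Proof.
move=> f2; apply: inL2_integrable_sqrP.
  by apply: measurableT_comp => //; exact: inL2_measurable.
have := inL2_integrable_sqr f2; congr (mu.-integrable _ (EFin \o _)).
by apply/funext => x; rewrite /= sqrrN.
Qed.

Lemma BintD r f g : mu.-integrable (Bset r) (EFin \o f) ->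
  mu.-integrable (Bset r) (EFin \o g) ->
  Bint r (fun x => f x + g x) = Bint r f + Bint r g.
Proof. by move=> fi gi; apply: RintegralD => //; exact: measurable_Bset. Qed.

Lemma BintB r f g : mu.-integrable (Bset r) (EFin \o f) ->
  mu.-integrable (Bset r) (EFin \o g) ->
  Bint r (fun x => f x - g x) = Bint r f - Bint r g.
Proof. by move=> fi gi; apply: RintegralB => //; exact: measurable_Bset. Qed.

Lemma BintZ r c f : mu.-integrable (Bset r) (EFin \o f) ->
  Bint r (fun x => c * f x) = c * Bint r f.
Proof. by move=> fi; apply: RintegralZl => //; exact: measurable_Bset. Qed.

Lemma eq_Bint r f g : f =1 g -> Bint r f = Bint r g.
Proof. by move=> /funext ->. Qed.

Lemma test_fun_continuous r phi : test_fun r phi ->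
  continuous phi /\ continuous (derive1 phi).
Proof.
by move=> [d c _]; split => // x; apply: differentiable_continuous; apply/derivable1_diffP.
Qed.

Lemma inL2_mul_measurable r f g : inL2 r f -> continuous g ->
  measurable_fun (Bset r) (fun x => f x * g x).
Proof.
move=> f2 gc; apply: measurable_funM; first exact: inL2_measurable.
by apply: measurable_funTS; exact: continuous_measurable_fun.
Qed.

Lemma eq_ae_Bint_mul r f f' g : inL2 r f -> inL2 r f' -> continuous g ->
  {ae mu, forall x, Bset r x -> f x = f' x} ->
  Bint r (fun x => f x * g x) = Bint r (fun x => f' x * g x).
Proof.
move=> f2 f2' gc ff'; apply: eq_ae_Bint; try exact: inL2_mul_measurable.
by apply: (@filterS _ _ (ae_filter_ringOfSetsType mu)) ff' => x /= h xB; rewrite h.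
Qed.

Lemma is_wderiv_ae r f f' g : inL2 r f' ->
  {ae mu, forall x, Bset r x -> f x = f' x} -> is_wderiv r f g -> is_wderiv r f' g.
Proof.
move=> f2' ff' [f2 g2 H]; split => // phi tp; rewrite -H//.
have [_ pc] := test_fun_continuous tp.
by rewrite (eq_ae_Bint_mul f2 f2' pc ff').
Qed.

Lemma is_wderiv_unique r f g g' : 0 < r -> is_wderiv r f g -> is_wderiv r f g' ->
  {ae mu, forall x, Bset r x -> g x = g' x}.
Proof.
move=> r0 [f2 g2 H] [_ g2' H'].
have d2 : inL2 r (g \+ \- g') by apply: inL2D => //; exact: inL2N.
have : {ae mu, forall x, Bset r x -> (g \+ \- g') x = 0}.
  apply: fundamental_lemma => // phi tp; have [pc _] := test_fun_continuous tp.
  have p2 := inL2_continuous r pc.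
  rewrite (@eq_Bint _ _ (fun x => g x * phi x - g' x * phi x)); last first.
    by move=> x; rewrite /= mulrDl mulNr.
  rewrite BintB; try exact: inL2_integrableM.
  have h1 := H _ tp; have h2 := H' _ tp; lra.
apply: (@filterS _ _ (ae_filter_ringOfSetsType mu)) => x /= h xB.
by apply/eqP; rewrite -subr_eq0; apply/eqP; exact: h.
Qed.

Lemma wderivP r f g : is_wderiv r f g -> is_wderiv r f (wderiv r f).
Proof. by move=> fg; exact: (@xgetPex _ _ [set h | is_wderiv r f h] (ex_intro _ g fg)). Qed.

(** Weak derivatives are unique almost everywhere, so that the chosen one may be
    replaced with any other. The second one is taken along the chosen first one,
    whence the detour through [is_wderiv_ae]. *)
Lemma wderiv_ae r f f1 f2 : 0 < r -> is_wderiv r f f1 -> is_wderiv r f1 f2 ->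
  [/\ is_wderiv r f (wderiv r f), is_wderiv r (wderiv r f) (wderiv r (wderiv r f)),
    {ae mu, forall x, Bset r x -> wderiv r f x = f1 x} &
    {ae mu, forall x, Bset r x -> wderiv r (wderiv r f) x = f2 x}].
Proof.
move=> r0 H1 H2; have W1 := wderivP H1.
have E1 := is_wderiv_unique r0 W1 H1; have E1' := is_wderiv_unique r0 H1 W1.
have L1 : inL2 r (wderiv r f) by case: W1.
have H2' := is_wderiv_ae L1 E1' H2.
have W2 := wderivP H2'.
by split => //; exact: is_wderiv_unique r0 W2 H2'.
Qed.

Lemma Bint_sqr_ae r f g : inL2 r f -> inL2 r g ->
  {ae mu, forall x, Bset r x -> f x = g x} ->
  Bint r (fun x => f x ^+ 2) = Bint r (fun x => g x ^+ 2).
Proof.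
move=> f2 g2 fg; apply: eq_ae_Bint.
- by apply: measurable_funX; exact: inL2_measurable.
- by apply: measurable_funX; exact: inL2_measurable.
by apply: (@filterS _ _ (ae_filter_ringOfSetsType mu)) fg => x /= h xB; rewrite h.
Qed.

Lemma energyE n r f f1 f2 : 0 < r -> is_wderiv r f f1 -> is_wderiv r f1 f2 ->
  energy n r f = - (2^-1 * Bint r (fun x => f2 x ^+ 2)) + 2^-1 * Bint r (fun x => f x ^+ 2)
    - (nu n)^-1 * Bint r (fun x => `|f x| `^ nu n).
Proof.
move=> r0 H1 H2; have [W1 W2 _ E2] := wderiv_ae r0 H1 H2.
rewrite /energy (@Bint_sqr_ae r (wderiv r (wderiv r f)) f2)//; first by case: W2.
by case: H2.
Qed.

Lemma W22normE r f f1 f2 : 0 < r -> is_wderiv r f f1 -> is_wderiv r f1 f2 ->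
  W22norm r f = Num.sqrt (Bint r (fun x => f x ^+ 2) + Bint r (fun x => f1 x ^+ 2)
    + Bint r (fun x => f2 x ^+ 2)).
Proof.
move=> r0 H1 H2; have [W1 W2 E1 E2] := wderiv_ae r0 H1 H2.
rewrite /W22norm (@Bint_sqr_ae r (wderiv r (wderiv r f)) f2)//; last 2 first.
- by case: W2.
- by case: H2.
rewrite (@Bint_sqr_ae r (wderiv r f) f1)//; first by case: W2.
by case: H2.
Qed.

Lemma is_wderivD r f g f1 g1 : is_wderiv r f f1 -> is_wderiv r g g1 ->
  is_wderiv r (f \+ g) (f1 \+ g1).
Proof.
move=> [f2 f12 Hf] [g2 g12 Hg]; split; try exact: inL2D.
move=> phi tp; have [pc p'c] := test_fun_continuous tp.
have p2 := inL2_continuous r pc; have p'2 := inL2_continuous r p'c.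
rewrite (@eq_Bint _ _ (fun x => f x * derive1 phi x + g x * derive1 phi x)); last first.
  by move=> x; rewrite /= mulrDl.
rewrite (@eq_Bint _ (fun x => (f1 \+ g1) x * _) (fun x => f1 x * phi x + g1 x * phi x)); last first.
  by move=> x; rewrite /= mulrDl.
rewrite BintD; try exact: inL2_integrableM.
rewrite BintD; try exact: inL2_integrableM.
by rewrite Hf// Hg// opprD.
Qed.

Lemma Bint_closed r f : continuous f -> Bint r f = Rintegral mu `[(- r), r] f.
Proof.
move=> cf.
have ci : mu.-integrable `[(- r), r] (EFin \o f).
  apply: continuous_compact_integrable; first exact: segment_compact.
  exact: continuous_subspaceT.
rewrite /Bint /Bset Rintegral_itv_bndo_bndc; last first.
  apply: integrableS ci => //; exact: subset_itv_oo_cc.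
rewrite Rintegral_itv_obnd_cbnd//.
apply: integrableS ci => //; exact: subset_itv_oc_cc.
Qed.

(** The test function vanishes at both ends, so f is free of boundary
    conditions. *)
Lemma is_wderiv_classical r f f1 : 0 < r -> (forall x, is_der f x (f1 x)) ->
  continuous f1 -> is_wderiv r f f1.
Proof.
move=> r0 df f1c.
have fc : continuous f by exact: der_continuous df.
have drv g (g1 : R -> R) : (forall x, is_der g x (g1 x)) -> derivable_oo_LRcontinuous g (- r) r.
  move=> dg; have gc : continuous g by move=> x; exact: (is_derive_cont (dg x)).
  split; first by move=> x _; have [] := dg x.
    exact: cvg_at_right_filter (gc _).
  exact: cvg_at_left_filter (gc _).
split; [exact: inL2_continuous|exact: inL2_continuous|].
move=> phi tp; have [pc p'c] := test_fun_continuous tp.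
have [pd _ [s sr Hs]] := tp.
have dphi x : is_der phi x (derive1 phi x).
  by rewrite derive1E; exact: derivableP.
rewrite !Bint_closed; last 2 first.
- by move=> x; apply: cvgM; [exact: f1c|exact: pc].
- by move=> x; apply: cvgM; [exact: fc|exact: p'c].
have rr : - r < r by lra.
have D g (g1 : R -> R) : (forall x, is_der g x (g1 x)) -> {in `]- r, r[, derive1 g =1 g1}.
  by move=> dg x _; rewrite (der_derive1 dg).
rewrite (@Rintegration_by_parts _ f phi f1 (derive1 phi) (- r) r rr
  (continuous_subspaceT f1c) (drv _ _ df) (D _ _ df)
  (continuous_subspaceT p'c) (drv _ _ dphi) (D _ _ dphi)).
rewrite !Hs ?normrN ?(gtr0_norm r0) ?(ltW sr)//.
by rewrite !mulr0 subrr sub0r.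
Qed.

End WeakDerivative.

(** * Integral estimates for the energy *)

Section CriticalPoint.
Context {R : realType}.
Notation mu := (@lebesgue_measure R).
Implicit Types (r a : R) (f g : R -> R).

(** For t = s x, compare x^(1+a) with 1 or x^2. Integrated with
    t = |f|, this bounds |f|^(1+a) by the square norm of f, the best scale s being
    that norm. *)
Lemma powR_le_sqr a s t : 0 < a < 1 -> 0 < s -> 0 <= t ->
  t `^ (1 + a) <= s `^ (1 + a) * (t ^+ 2 / s ^+ 2 + 1).
Proof.
move=> /andP[a0 a1] s0 t0; have ts0 : 0 <= t / s by rewrite divr_ge0// ltW.
have {1}-> : t = s * (t / s) by rewrite mulrCA mulfV ?mulr1// gt_eqF.
rewrite powRM// ?(ltW s0)//; apply: ler_wpM2l; first exact: powR_ge0.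
rewrite -expr_div_n; have := sqr_ge0 (t / s).
have [h|h] := leP (t / s) 1.
  have : (t / s) `^ (1 + a) <= 1 `^ (1 + a) by apply: ge0_ler_powR; rewrite ?nnegrE//; lra.
  rewrite powR1; lra.
have : (t / s) `^ (1 + a) <= (t / s) `^ 2%:R by apply: ler_powR; lra.
rewrite powR_mulrn//; lra.
Qed.

Lemma inL2_integrable r f : inL2 r f -> mu.-integrable (Bset r) (EFin \o f).
Proof.
move=> f2; have := inL2_integrableM f2 (@inL2_continuous _ r (fun=> 1) (@cst_continuous _ _ _)).
by rewrite (_ : (fun x => f x * 1) = f)//; apply/funext => x; rewrite mulr1.
Qed.

Lemma inL2_powR_integrable r a f : 0 < a < 1 -> inL2 r f ->
  mu.-integrable (Bset r) (EFin \o (fun x => `|f x| `^ (1 + a))).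
Proof.
move=> a01 f2.
have c1 : inL2 r (fun=> 1 : R) by apply: inL2_continuous; exact: cst_continuous.
have g : mu.-integrable (Bset r) (EFin \o (fun x => f x ^+ 2 + 1)).
  exact: (integrableD (measurable_Bset r) (inL2_integrable_sqr f2) (inL2_integrable c1)).
apply: (le_integrable (measurable_Bset r) _ _ g).
  apply/measurable_EFinP; apply: (measurableT_comp (measurable_powR _)).
  by apply: measurableT_comp => //; exact: inL2_measurable.
move=> x _; rewrite /= lee_fin (ger0_norm (powR_ge0 _ _)).
rewrite (ger0_norm (addr_ge0 (sqr_ge0 _) ler01)).
have := powR_le_sqr a01 ltr01 (normr_ge0 (f x)).
by rewrite powR1 /= mul1r expr1n divr1 real_normK ?num_real.
Qed.

Lemma le_Bint r f g : mu.-integrable (Bset r) (EFin \o f) ->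
  mu.-integrable (Bset r) (EFin \o g) -> (forall x, f x <= g x) -> Bint r f <= Bint r g.
Proof.
by move=> fi gi fg; apply: (le_Rintegral (measurable_Bset r) fi gi) => x _; exact: fg.
Qed.

Lemma Bint_sqr_ge0 r f : 0 <= Bint r (fun x => f x ^+ 2).
Proof. by apply: Rintegral_ge0 => x _; exact: sqr_ge0. Qed.

Lemma Bint_cst r c : 0 < r -> Bint r (fun=> c) = c * (2 * r).
Proof.
move=> r0; have h : - r < r by lra.
transitivity (c * fine (mu (Bset r))); first exact: (Rintegral_cst mu (measurable_Bset r) c).
by rewrite /Bset lebesgue_measure_itv /= lte_fin h /=; ring.
Qed.

Lemma Bint_powR_le r a s f : 0 < r -> 0 < a < 1 -> 0 < s -> inL2 r f ->
  Bint r (fun x => f x ^+ 2) <= s ^+ 2 ->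
  Bint r (fun x => `|f x| `^ (1 + a)) <= s `^ (1 + a) * (1 + 2 * r).
Proof.
move=> r0 a01 s0 f2 fs; have s20 : 0 < s ^+ 2 by exact: exprn_gt0.
have c1 : inL2 r (fun=> 1 : R) by apply: inL2_continuous; exact: cst_continuous.
have i1 := inL2_integrable_sqr f2.
have i2 : mu.-integrable (Bset r) (EFin \o (fun x => (s ^+ 2)^-1 * f x ^+ 2)).
  have := integrableZl (measurable_Bset r) (s ^+ 2)^-1 i1.
  by congr (mu.-integrable _ _); apply/funext => x; rewrite /= EFinM.
have i3 : mu.-integrable (Bset r) (EFin \o (fun x => (s ^+ 2)^-1 * f x ^+ 2 + 1)).
  exact: (integrableD (measurable_Bset r) i2 (inL2_integrable c1)).
have i4 : mu.-integrable (Bset r)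
    (EFin \o (fun x => s `^ (1 + a) * ((s ^+ 2)^-1 * f x ^+ 2 + 1))).
  have := integrableZl (measurable_Bset r) (s `^ (1 + a)) i3.
  by congr (mu.-integrable _ _); apply/funext => x; rewrite /= EFinM.
apply: (le_trans (le_Bint (inL2_powR_integrable a01 f2) i4 _)).
  move=> x; have := powR_le_sqr a01 s0 (normr_ge0 (f x)).
  by rewrite real_normK ?num_real// (mulrC (_ ^+ 2)).
rewrite BintZ// BintD//; last exact: (inL2_integrable c1).
rewrite BintZ// Bint_cst// mul1r; apply: ler_wpM2l; first exact: powR_ge0.
by rewrite lerD2r mulrC ler_pdivrMr// mul1r.
Qed.

Lemma Bint_sqrD r f g : inL2 r f -> inL2 r g ->
  Bint r (fun x => (f x + g x) ^+ 2) = Bint r (fun x => f x ^+ 2)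
   + 2 * Bint r (fun x => f x * g x) + Bint r (fun x => g x ^+ 2).
Proof.
move=> f2 g2; have i1 := inL2_integrable_sqr f2; have i2 := inL2_integrable_sqr g2.
have i3 := inL2_integrableM f2 g2.
have i4 : mu.-integrable (Bset r) (EFin \o (fun x => 2 * (f x * g x))).
  have := integrableZl (measurable_Bset r) 2 i3.
  by congr (mu.-integrable _ _); apply/funext => x; rewrite /= EFinM.
rewrite (@eq_Bint _ _ _ (fun x => (f x ^+ 2 + 2 * (f x * g x)) + g x ^+ 2)); last first.
  by move=> x; ring.
rewrite BintD//; last exact: (integrableD (measurable_Bset r) i1 i4).
by rewrite BintD// BintZ.
Qed.

(** Integrated form of [abs_powR_taylor]. *)
Lemma Bint_powR_taylor r a f g : 0 < a < 1 -> continuous f -> inL2 r g ->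
  `| Bint r (fun x => `|f x + g x| `^ (1 + a)) - Bint r (fun x => `|f x| `^ (1 + a))
     - (1 + a) * Bint r (fun x => spow a (f x) * g x) | <=
  4 * Bint r (fun x => `|g x| `^ (1 + a)).
Proof.
move=> a01 fc g2; have f2 := inL2_continuous r fc; have /andP[a0 a1] := a01.
have a01' : 0 < a <= 1 by rewrite a0 ltW.
have sc : continuous (fun x => spow a (f x)).
  by move=> x; apply: continuous_cvg; [exact: continuous_spow|exact: fc].
have i1 := inL2_powR_integrable a01 (inL2D f2 g2).
have i2 := inL2_powR_integrable a01 f2.
have i3 := inL2_integrableM (inL2_continuous r sc) g2.
have i4 : mu.-integrable (Bset r) (EFin \o (fun x => (1 + a) * (spow a (f x) * g x))).
  have := integrableZl (measurable_Bset r) (1 + a) i3.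
  by congr (mu.-integrable _ _); apply/funext => x; rewrite /= EFinM.
have i5 := inL2_powR_integrable a01 g2.
have i6 : mu.-integrable (Bset r) (EFin \o (fun x => 4 * `|g x| `^ (1 + a))).
  have := integrableZl (measurable_Bset r) 4 i5.
  by congr (mu.-integrable _ _); apply/funext => x; rewrite /= EFinM.
have i12 := integrableB (measurable_Bset r) i1 i2.
have i124 := integrableB (measurable_Bset r) i12 i4.
rewrite -(BintZ _ i3) -(BintB i1 i2) -(@BintB _ _ _ _ i12 i4) -(BintZ _ i5).
apply: (le_trans (le_normr_Rintegral (measurable_Bset r) i124)).
apply: le_Bint => //; first exact: integrable_norm i124.
by move=> x; rewrite mulrA; exact: abs_powR_taylor.
Qed.

End CriticalPoint.

(** * Criticality and the theorem *)

Section Criticality.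
Context {R : realType}.
Notation mu := (@lebesgue_measure R).
Implicit Types (r a : R) (f g : R -> R).

(** F'' and F''' have compact support in B_r and are continuously
    differentiable, hence are test functions for V' and V; then F'''' is
    replaced using the equation. *)
Lemma Bint_second_derivative r a s (F F1 F2 F3 V V1 V2 : R -> R) :
  0 < a < 1 -> ode_chain a 1 1 F F1 F2 F3 -> s < r ->
  (forall x, s <= `|x| -> F x = 0) -> is_wderiv r V V1 -> is_wderiv r V1 V2 ->
  Bint r (fun x => F2 x * V2 x) = Bint r (fun x => F x * V x) -
    Bint r (fun x => spow a (F x) * V x).
Proof.
move=> a01 [dF dF1 dF2 dF3] sr F0 [V22 V12 HV] [_ V2L HV1].
have F0' x : s < `|x| -> F x = 0 by move=> /ltW; exact: F0.
have F10 := der_vanish dF F0'; have F20 := der_vanish dF1 F10.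
have F30 := der_vanish dF2 F20.
have Fc : continuous F by exact: der_continuous dF.
have F3c : continuous F3 by exact: der_continuous dF3.
have a01' : 0 < a <= 1 by lra.
have sc : continuous (fun x => spow a (F x)).
  by move=> x; apply: continuous_cvg; [exact: continuous_spow|exact: Fc].
have D2 : derive1 F2 = F3.
  by exact: der_derive1 dF2.
have D3 : derive1 F3 = fun x => F x - spow a (F x).
  apply/funext => x; rewrite derive1E (@derive_val _ _ _ _ _ _ _ (dF3 x)).
  by rewrite !mul1r.
have s's : s < (s + r) / 2 by lra.
have t2 : test_fun r F2.
  split; first by move=> x; have [] := dF2 x.
    by rewrite D2.
  by exists ((s + r) / 2); [lra|move=> x sx; apply: F20; lra].
have t3 : test_fun r F3.
  split; first by move=> x; have [] := dF3 x.
    by rewrite D3 => x; apply: cvgB; [exact: Fc|exact: sc].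
  by exists ((s + r) / 2); [lra|move=> x sx; apply: F30; lra].
have h1 := HV1 _ t2; have h2 := HV _ t3; rewrite D2 in h1; rewrite D3 in h2.
rewrite (@eq_Bint _ _ _ (fun x => V2 x * F2 x)); last by move=> x; rewrite mulrC.
rewrite -(BintB (inL2_integrableM (inL2_continuous r Fc) V22)
  (inL2_integrableM (inL2_continuous r sc) V22)).
rewrite (@eq_Bint _ _ (fun x => _ - _) (fun x => V x * (F x - spow a (F x)))); last first.
  by move=> x; ring.
by rewrite h2 h1 opprK.
Qed.

Lemma nuE (n : R) : 0 < n -> nu n = 1 + (n + 1)^-1.
Proof. by move=> n0; rewrite /nu; field; rewrite gt_eqF//; lra. Qed.

(** The terms linear in V cancel by [Bint_second_derivative]. *)
Lemma energy_increment r n s t (F F1 F2 F3 V V1 V2 : R -> R) (a := (n + 1)^-1) :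
  0 < n -> 0 < r -> ode_chain a 1 1 F F1 F2 F3 -> s < r ->
  (forall x, s <= `|x| -> F x = 0) -> is_wderiv r V V1 -> is_wderiv r V1 V2 ->
  0 < t -> W22norm r V <= t ->
  `|energy n r (F \+ V) - energy n r F| <= t ^+ 2 + 4 * (t `^ (1 + a) * (1 + 2 * r)).
Proof.
move=> n0 r0 HF sr F0 HV HV1 t0 Nt.
have a01 : 0 < a < 1 by rewrite invr_gt0 invf_lt1; lra.
have /andP[a0 a1] := a01.
have [dF dF1 dF2 dF3] := HF.
have Fc : continuous F by exact: der_continuous dF.
have F1c : continuous F1 by exact: der_continuous dF1.
have F2c : continuous F2 by exact: der_continuous dF2.
have WF := is_wderiv_classical r0 dF F1c.
have WF1 := is_wderiv_classical r0 dF1 F2c.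
have V22 : inL2 r V by case: HV.
have V2L : inL2 r V2 by case: HV1.
rewrite (energyE n r0 (is_wderivD WF HV) (is_wderivD WF1 HV1)) (energyE n r0 WF WF1).
rewrite (Bint_sqrD (inL2_continuous r F2c) V2L) (Bint_sqrD (inL2_continuous r Fc) V22).
rewrite (Bint_second_derivative a01 HF sr F0 HV HV1).
have [v0 v1 v2] : [/\ 0 <= Bint r (fun x => V x ^+ 2), 0 <= Bint r (fun x => V1 x ^+ 2)
  & 0 <= Bint r (fun x => V2 x ^+ 2)] by split; exact: Bint_sqr_ge0.
have Nt2 : Bint r (fun x => V x ^+ 2) + Bint r (fun x => V1 x ^+ 2)
    + Bint r (fun x => V2 x ^+ 2) <= t ^+ 2.
  move: Nt; rewrite (W22normE r0 HV HV1) => Nt.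
  rewrite -[leLHS]sqr_sqrtr; last by lra.
  by rewrite ler_sqr ?nnegrE ?sqrtr_ge0// ltW.
have Vt : Bint r (fun x => V x ^+ 2) <= t ^+ 2 by lra.
have hV := Bint_powR_le r0 a01 t0 V22 Vt.
have := Bint_powR_taylor a01 Fc V22.
have -> : nu n = 1 + a by exact: nuE.
rewrite (@eq_Bint _ _ (fun x => `|(F \+ V) x| `^ _) (fun x => `|F x + V x| `^ (1 + a)))//.
move: (Bint r (fun x => `|F x + V x| `^ _)) (Bint r (fun x => `|F x| `^ _)) => A B.
move: (Bint r (fun x => spow a (F x) * V x)) (Bint r (fun x => F x * V x)) => L P.
move: hV v0 v1 v2 Nt2.
move: (Bint r (fun x => `|V x| `^ _)) (t `^ (1 + a) * _) => Q T.
move: (Bint r (fun x => V x ^+ 2)) (Bint r (fun x => V1 x ^+ 2)) (Bint r (fun x => V2 x ^+ 2)).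
move: (Bint r (fun x => F x ^+ 2)) (Bint r (fun x => F2 x ^+ 2)) => X Y p q w hQ p0 q0 w0 hn.
clear -hQ p0 q0 w0 hn a0 a1.
have ia0 : 0 < (1 + a)^-1 by rewrite invr_gt0; lra.
have ia1 : (1 + a)^-1 <= 1 by rewrite invf_le1; lra.
have E : (1 + a)^-1 * ((1 + a) * L) = L by rewrite mulrA mulVf ?mul1r// gt_eqF//; lra.
move=> H; set Z := A - B - (1 + a) * L in H.
have -> : - (2^-1 * (Y + 2 * (P - L) + w)) + 2^-1 * (X + 2 * P + p) - (1 + a)^-1 * A -
   (- (2^-1 * Y) + 2^-1 * X - (1 + a)^-1 * B) = 2^-1 * (p - w) - (1 + a)^-1 * Z.
  by rewrite /Z [_^-1 * (_ - _ - _)]mulrBr E; move: (1 + a)^-1 => ia; field.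
have Z1 : `|(1 + a)^-1 * Z| <= 4 * T.
  rewrite normrM gtr0_norm//; apply: (@le_trans _ _ (1 * `|Z|)); first by rewrite ler_wpM2r.
  rewrite mul1r; lra.
move: Z1; rewrite !ler_norml; lra.
Qed.

(** [energy_increment] is used with t = |V|, except when |V| = 0, where all small
    t > 0 are used. *)
Lemma solution_critical r n s (F F1 F2 F3 : R -> R) (a := (n + 1)^-1) :
  0 < n -> 0 < r -> ode_chain a 1 1 F F1 F2 F3 -> s < r ->
  (forall x, s <= `|x| -> F x = 0) -> critical_point r (energy n r) F.
Proof.
move=> n0 r0 HF sr F0; have [dF dF1 dF2 dF3] := HF.
have a01 : 0 < a < 1 by rewrite invr_gt0 invf_lt1; lra.
have /andP[a0 a1] := a01.
have Fc : continuous F by exact: der_continuous dF.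
have F1c : continuous F1 by exact: der_continuous dF1.
have F2c : continuous F2 by exact: der_continuous dF2.
have F0' x : s < `|x| -> F x = 0 by move=> /ltW; exact: F0.
have F10 := der_vanish dF F0'.
split.
  exists F1, F2; split.
  - exact: is_wderiv_classical.
  - exact: is_wderiv_classical.
  - exists F; split; [exact: aeW|exact: continuous_subspaceT| |].
      by rewrite F0// normrN gtr0_norm// ltW.
    by rewrite F0// gtr0_norm// ltW.
  - exists F1; split; [exact: aeW|exact: continuous_subspaceT| |].
      by rewrite F10// normrN gtr0_norm.
    by rewrite F10// gtr0_norm.
move=> e e0; pose C := 8 * (1 + 2 * r).
have C0 : 0 < C by rewrite /C; lra.
have [d d0 Hd] := powR_small a0 (divr_gt0 e0 C0).
exists (Num.min d (e / 2)); first by rewrite lt_min d0 divr_gt0.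
move=> V [V1 [V2 [HV HV1 _ _]]] Nd.
have N0 : 0 <= W22norm r V by exact: sqrtr_ge0.
set D := `|_ - _|.
have key t : 0 < t -> W22norm r V <= t -> t <= Num.min d (e / 2) -> D <= e * t.
  move=> t0 Nt; rewrite le_min => /andP[td te].
  apply: (le_trans (energy_increment n0 r0 HF sr F0 HV HV1 t0 Nt)).
  have ta : t `^ a <= e / C by apply: Hd; rewrite td ltW.
  rewrite ler_pdivlMr// in ta.
  rewrite powRD ?(gt_eqF t0) ?implybT// powRr1 ?(ltW t0)//.
  have -> : t ^+ 2 + 4 * (t * t `^ a * (1 + 2 * r)) = t * (t + t `^ a * C / 2).
    by rewrite /C; field.
  rewrite [leRHS]mulrC ler_pM2l//; lra.
have [Np|Nz] := ltP 0 (W22norm r V); first exact: key.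
have -> : W22norm r V = 0 by apply/eqP; rewrite eq_le Nz.
rewrite mulr0 leNgt; apply/negP => D0.
pose t := Num.min (Num.min d (e / 2)) (D / (2 * e)).
have e20 : 0 < 2 * e by lra.
have t0 : 0 < t by rewrite !lt_min d0 !divr_gt0.
have tD : t <= D / (2 * e) by rewrite ge_min lexx orbT.
have := key t t0 (le_trans Nz (ltW t0)); rewrite ge_min lexx => /(_ isT).
rewrite ler_pdivlMr// in tD; lra.
Qed.

Lemma ode_chain_solves n (F F1 F2 F3 : R -> R) : 0 < n ->
  ode_chain (n + 1)^-1 1 1 F F1 F2 F3 -> solves_ode n F.
Proof.
move=> n0 [dF dF1 dF2 dF3].
have e1 : derive1 F = F1.
  by exact: der_derive1 dF.
have e2 : derive1 F1 = F2.
  by exact: der_derive1 dF1.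
have e3 : derive1 F2 = F3.
  by exact: der_derive1 dF2.
split.
  move=> [|[|[|[|//]]]] x _; rewrite /derive1n /= ?e1 ?e2 ?e3.
  - by have [] := dF x.
  - by have [] := dF1 x.
  - by have [] := dF2 x.
  - by have [] := dF3 x.
move=> x; rewrite /derive1n /= e1 e2 e3 derive1E (@derive_val _ _ _ _ _ _ _ (dF3 x)).
by rewrite !mul1r.
Qed.

End Criticality.

Theorem proposition5p2 (R : realType) (n : R) (hn : 0 < n) :
  exists F : nat -> R -> R,
    injective F /\
    forall l : nat,
      solves_ode n (F l) /\
      exists2 r0 : R, 0 < r0 &
        forall r : R, r0 <= r -> critical_point r (energy n r) (F l).
Proof.
pose a := (n + 1)^-1.
have a01 : 0 < a < 1 by rewrite invr_gt0 invf_lt1; lra.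
have a0 : 0 < a by case/andP: a01.
have [F [F1 [F2 [F3 [HF F0 [s s0 Fs]]]]]] := compact_solution a01.
have HFl (l : nat) := ode_chain_affine (- (l%:R * s)) 1 a0 ltr01 HF.
exists (fun l y => 1 * F (- (l%:R * s) + 1 * y)); split.
  (* At l s the l-th translate is F(0), while the others are outside of the support. *)
  move=> l m lm; apply/eqP/negPn/negP => lm0.
  have := congr1 (fun g : R -> R => g (l%:R * s)) lm.
  rewrite !mul1r addNr (Fs (- (m%:R * s) + l%:R * s)); first by move=> e; rewrite e eqxx in F0.
  rewrite addrC -mulrBl normrM (gtr0_norm s0) ler_peMl ?(ltW s0)//.
  have [h|h|h] := ltngtP l m; last by rewrite h eqxx in lm0.
    by rewrite distrC -natrB ?(ltnW h)// normr_nat ler1n subn_gt0.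
  by rewrite -natrB ?(ltnW h)// normr_nat ler1n subn_gt0.
move=> l; have := HFl l; rewrite powR1 !expr1n !mulr1 => Hl; split.
  exact: ode_chain_solves Hl.
pose s' := l%:R * s + s.
have s'0 : 0 < s' by rewrite ltr_wpDl// mulr_ge0// ltW.
exists (s' + 1); first by rewrite addr_gt0.
move=> r hr; apply: (solution_critical (s := s') hn _ Hl); try lra.
move=> x hx; rewrite Fs ?mulr0// mul1r addrC.
have h : `|x| <= `|x - l%:R * s| + `|l%:R * s|.
  by have := ler_normD (x - l%:R * s) (l%:R * s); rewrite subrK.
have h2 : `|l%:R * s| = l%:R * s by rewrite ger0_norm// mulr_ge0// ltW.
by move: hx; rewrite /s' => hx; rewrite h2 in h; lra.
Qed.
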